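(* There is an absolute constant $C>0$ such that the following holds. For each $n$, let $A$ be a set of $n$ random points chosen independently and uniformly from the unit square $[0,1]^2$. Then, with probability tending to $1$ as $n\to\infty$, both of the following hold: the edge set of the complete geometric graph $K_n[A]$ can be covered by at most $C\,n\log n$ crossing-free paths, and the edge set of $K_n[A]$ can be covered by at most $C\,n\sqrt{\log n}$ crossing-free matchings.
   Context: A set of points in the plane is in general position if no three of its points are collinear (a random set $A$ as in the claim is in general position with probability $1$). For an $n$-point set $A$ in general position in the plane, the complete geometric graph $K_n[A]$ has vertex set $A$, and its edges are all $\binom n2$ straight-line segments between points of $A$. Paths and matchings here are paths and matchings in $K_n[A]$, drawn with these straight-line edges. Such a subgraph is crossing-free (plane) if no two of its edges cross each other. A family of subgraphs covers the edge set of $K_n[A]$ if every edge of $K_n[A]$ belongs to at least one member of the family. Logarithms are in base $2$. *)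

(* Defs.v *)
From mathcomp Require Import all_boot all_order all_algebra.
From mathcomp Require Import all_classical all_reals all_analysis.

Set Implicit Arguments.
Unset Strict Implicit.
Unset Printing Implicit Defensive.

Import Order.TTheory GRing.Theory Num.Theory.
Import numFieldNormedType.Exports.

Local Open Scope ring_scope.

Section PointSets.
Variables (R : realType) (n : nat).

Definition collinear (x y z : R * R) : Prop :=
  exists a b c : R, (a, b) != (0, 0) /\
    forall q : R * R, q \in [:: x; y; z] -> a * q.1 + b * q.2 = c.

Definition open_segment (x y : R * R) : set (R * R) :=
  [set (1 - t) *: x + t *: y | t in `]0, 1[ ]%classic.

(* A point set is given by a labelling p of its points; injectivity says that
   there really are n of them. *)
Definition general_position (p : 'I_n -> R * R) : Prop :=
  injective p /\
  forall i j k : 'I_n, i != j -> j != k -> i != k ->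
    ~ collinear (p i) (p j) (p k).

End PointSets.

(* Vertices of the complete geometric graph are the labels, edges are the
   two-element sets of labels; a subgraph is represented by its edge set. *)
Section CompleteGeometricGraph.
Variables (R : realType) (n : nat) (p : 'I_n -> R * R).
Local Open Scope set_scope.

Definition complete_edges : {set {set 'I_n}} := [set e : {set 'I_n} | #|e| == 2%N].

(* When p is in general position, open segments of edges sharing exactly one
   endpoint are disjoint, so this only concerns edges without a common
   endpoint. *)
Definition edges_cross (e f : {set 'I_n}) : Prop :=
  exists i j k l : 'I_n, [/\ e = [set i; j]%SET, f = [set k; l]%SET, e != f &
    (open_segment (p i) (p j) `&` open_segment (p k) (p l) !=set0)%classic].

Definition crossing_free (E : {set {set 'I_n}}) : Prop :=
  forall e f : {set 'I_n}, e \in E -> f \in E -> ~ edges_cross e f.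

(* Edge set of the path visiting the vertices of s in order. *)
Definition walk_edges (s : seq 'I_n) : {set {set 'I_n}} :=
  [set e in [seq [set v.1; v.2]%SET | v <- zip s (behead s)]]%SET.

Definition is_path (E : {set {set 'I_n}}) : Prop :=
  exists (v : 'I_n) (s : seq 'I_n), uniq (v :: s) /\ E = walk_edges (v :: s).

Definition is_matching (E : {set {set 'I_n}}) : Prop :=
  E \subset complete_edges /\
  {in E &, forall e f : {set 'I_n}, e != f -> [disjoint e & f]}.

Definition covered_by_at_most (x : R) (Q : {set {set 'I_n}} -> Prop) : Prop :=
  exists F : {set {set {set 'I_n}}},
    [/\ #|F|%:R <= x, forall E, E \in F -> Q E & complete_edges \subset finset.cover F].

End CompleteGeometricGraph.

Definition log2 (R : realType) (x : R) : R := ln x / ln 2.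

Definition covering_event (R : realType) (C : R) (n : nat)
    (p : 'I_n -> R * R) : Prop :=
  covered_by_at_most (C * (n%:R * log2 n%:R))
    (fun E => is_path E /\ crossing_free p E) /\
  covered_by_at_most (C * (n%:R * Num.sqrt (log2 n%:R)))
    (fun E => is_matching E /\ crossing_free p E).

Section RandomPoints.
Local Open Scope classical_set_scope.
Local Open Scope ereal_scope.

Definition mutually_independent d (T : measurableType d) d'
    (T' : measurableType d') (R : realType) (P : probability T R)
    (I : finType) (X : I -> {RV P >-> T'}) : Prop :=
  forall (J : {set I}) (B : I -> set T'), (forall i, measurable (B i)) ->
    P (\bigcap_(i in [set` J]) (X i @^-1` B i)) =
    \prod_(i in J) P (X i @^-1` B i).

Definition unit_square (R : realType) : set (R * R) := `[0%R, 1%R]%classic `*` `[0%R, 1%R]%classic.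

Definition uniform_on_unit_square d (T : measurableType d) (R : realType)
    (P : probability T R) (X : {RV P >-> (R * R)%type}) : Prop :=
  forall B : set (R * R), measurable B ->
    distribution P X B =
    (lebesgue_measure \x lebesgue_measure) (B `&` @unit_square R).

End RandomPoints.

(* Main.v *)
Require Import Defs.
From mathcomp Require Import all_boot all_order all_algebra.
From mathcomp Require Import all_classical all_reals all_analysis.
From mathcomp Require Import measurable_realfun.
From mathcomp Require Import zify ring lra.

(** Let a be a power of 4 of the order of log n, and K of the order of n / a. For each
    of O(K) directions the plane is cut into parallel strips of width 2 / K, in such a
    way that any two points of the unit square lie in a common strip of some direction
    ([common_strip]). A union bound over the m-subsets of the points shows that, with
    probability tending to 1, no strip contains m = 64 a points ([prob_overfull]).
    What remains is a deterministic statement about points in general position.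

    Paths. Fix a direction and two ranks, and take in each strip the pair of points
    with these ranks. Visiting all these points in the order transverse to the strips
    gives a monotone path, hence a crossing-free one, on which every chosen pair is
    consecutive. This makes O(K m^2) = O(n log n) paths ([strips_path_cover]).

    Matchings. Edges in different strips of one direction do not meet, so the strips
    can be treated in parallel ([strips_matching_cover]) and it suffices to cover the
    complete geometric graph on m points by O(m^(3/2)) plane matchings, for a total of
    O(K m^(3/2)) = O(n sqrt(log n)). Halving the points by a vertical line, recursively,
    reduces this to the edges that cross a line ([matchable_pow4]). Such a bipartite
    graph on v points without k + 1 pairwise disjoint edges has at most 6 k^2 v edges
    ([leq_card_no_stack]), so that removing large plane matchings one after the other
    exhausts it in O(v^(3/2)) steps ([stacked_cover_square]).

    The bound 6 k^2 v comes from four partial orders on disjoint edges crossing a line: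
    e below f, according to how the left ends and the right ends of e and f compare.
    Give each edge, for each order, the maximal length of a chain below it, which is
    less than k. If g, e, f is a zigzag going upwards, then g and f are disjoint, so a
    rank increases strictly from g to f. Discarding the O(k^2 v) edges that are
    lowest at their right end among those with the same ranks, every edge e is in a
    zigzag with g of the same ranks as e; hence the ranks of the remaining edges at a
    left end are strictly increasing with the slope, in a sense which leaves room for
    4 k^2 of them only.

    Two points concern the event itself. It is measurable because, in general position,
    crossings are determined by the signs of finitely many determinants
    ([edges_crossE], [covering_event_measurable]). And general position has probability
    at least 1 - 288 / n by the same union bound, because three collinear points of the
    square lie in a common strip however thin the strips are; here K is n^4 and m is 3. *)

Set Implicit Arguments.
Unset Strict Implicit.
Unset Printing Implicit Defensive.
Import Order.TTheory GRing.Theory Num.Theory.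
Import numFieldNormedType.Exports.
Local Open Scope classical_set_scope.
Local Open Scope ring_scope.

(** * Heights of chains in a strict order *)

Section ChainRank.
Local Open Scope nat_scope.
Local Open Scope set_scope.
Variables (T : finType) (r : rel T).
Implicit Types (A E : {set T}) (e g : T).

Definition chain A := [forall x in A, forall y in A, (x != y) ==> (r x y || r y x)].

Definition chain_below E e A :=
  [&& A \subset E, chain A & [forall x in A, r x e]].

(** Counting the chains strictly below e, and not through e, makes the rank
    depend on e only through its lower set: it is monotone for inclusion of
    lower sets, even between incomparable elements. *)
Definition chain_rank E e := \max_(A in chain_below E e) #|A|.

Lemma chainP A :
  reflect {in A &, forall x y, x != y -> r x y || r y x} (chain A).
Proof.
apply: (iffP forall_inP) => [h x y xA yA xy|h x xA].
  by have /forall_inP/(_ _ yA)/implyP := h x xA; exact.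
by apply/forall_inP => y yA; apply/implyP; exact: h.
Qed.

Lemma chain_belowP E e A :
  reflect [/\ A \subset E, {in A &, forall x y, x != y -> r x y || r y x} &
             {in A, forall x, r x e}] (chain_below E e A).
Proof.
by apply: (iffP and3P) => -[AE /chainP cA /forall_inP Ae].
Qed.

Lemma chain_rank_attained E e :
  exists2 A : {set T}, chain_below E e A & chain_rank E e = #|A|.
Proof.
have h : (0 < #|chain_below E e|)%N.
  apply/card_gt0P; exists (finset.set0 : {set T}); apply/chain_belowP.
  by split=> [|x y|x]; rewrite ?finset.sub0set ?inE.
by have [A hA eA] := eq_bigmax_cond (fun A : {set T} => #|A|) h; exists A.
Qed.

Lemma leq_card_chain_rank E e A : chain_below E e A -> #|A| <= chain_rank E e.
Proof. by move=> hA; apply: (@leq_bigmax_cond _ (mem (chain_below E e)) (fun B : {set T} => #|B|)). Qed.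

Lemma leq_chain_rank E e e' :
  {in E, forall g, r g e -> r g e'} -> chain_rank E e <= chain_rank E e'.
Proof.
move=> h; have [A /chain_belowP[AE cA Ae] ->] := chain_rank_attained E e.
apply: leq_card_chain_rank; apply/chain_belowP; split=> // x xA.
by apply: h (Ae _ xA); exact: (fintype.subsetP AE).
Qed.

Lemma chain_below_setU1 E e A : irreflexive r -> e \in E -> chain_below E e A ->
  [/\ e |: A \subset E, {in e |: A &, forall x y, x != y -> r x y || r y x} &
      #|e |: A| = #|A|.+1].
Proof.
move=> rI eE /chain_belowP[AE cA Ae]; split.
- by rewrite finset.subUset AE finset.sub1set eE.
- move=> x y /finset.setU1P[->|xA] /finset.setU1P[->|yA]; first by rewrite eqxx.
  + by rewrite Ae // orbT.
  + by rewrite Ae.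
  + exact: cA.
- by rewrite cardsU1; case: (boolP (e \in A)) => // /Ae; rewrite rI.
Qed.

Lemma ltn_chain_rank E e g : irreflexive r -> transitive r ->
  g \in E -> r g e -> chain_rank E g < chain_rank E e.
Proof.
move=> rI rT gE ge; have [A hA ->] := chain_rank_attained E g.
have [AE cA <-] := chain_below_setU1 rI gE hA.
apply: leq_card_chain_rank; apply/chain_belowP; split => // x /finset.setU1P[->//|xA].
by apply: rT ge; case/chain_belowP: hA => _ _; exact.
Qed.

Lemma chain_rank_bound E e k : irreflexive r ->
  (forall A : {set T}, A \subset E ->
     {in A &, forall x y, x != y -> r x y || r y x} -> #|A| <= k) ->
  e \in E -> chain_rank E e < k.
Proof.
move=> rI hk eE; have [A hA ->] := chain_rank_attained E e.
by have [AE cA <-] := chain_below_setU1 rI eE hA; apply: hk.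
Qed.

End ChainRank.

Lemma leq_card_triples (T : finType) n (A : {set T}) (V : {set 'I_n}) (f : T -> 'I_n)
    (a b : T -> nat) (k l : nat) :
  {in A, forall t, [/\ f t \in V, (a t < k)%N & (b t < l)%N]} ->
  {in A &, forall t u, f t = f u -> a t = a u -> b t = b u -> t = u} ->
  (#|A| <= #|V| * (k * l))%N.
Proof.
move=> h inj; have [->|/finset.set0Pn[t0 t0A]] := eqVneq A finset.set0.
  by rewrite cards0.
have [_ k0 l0] := h _ t0A.
case: k l k0 l0 h => // k [//|l] _ _ h.
pose g t : 'I_n * ('I_k.+1 * 'I_l.+1) := (f t, (inord (a t), inord (b t))).
have <- : #|g @: A| = #|A|.
  apply: card_in_imset => t u tA uA [e1 e2 e3].
  have [_ ta tb] := h _ tA; have [_ ua ub] := h _ uA.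
  apply: inj => //.
    by move: e2 => /(congr1 (@nat_of_ord _)); rewrite !inordK.
  by move: e3 => /(congr1 (@nat_of_ord _)); rewrite !inordK.
have -> : (#|V| * (k.+1 * l.+1))%N = #|finset.setX V [set: 'I_k.+1 * 'I_l.+1]%SET|.
  by rewrite cardsX cardsT card_prod !card_ord.
apply: subset_leq_card; apply/fintype.subsetP => _ /imsetP[t tA ->].
by rewrite inE /=; have [-> _ _] := h _ tA; rewrite inE.
Qed.

(** * Edges across a vertical line without large plane matchings *)

Section Bipartite.
Variables (R : realType) (n : nat) (x y : 'I_n -> R) (z : R).
Implicit Types (e f g : 'I_n * 'I_n) (E M : {set 'I_n * 'I_n}).

Definition slope e := (y e.2 - y e.1) / (x e.2 - x e.1).

Definition height e t := y e.1 + slope e * (t - x e.1).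

Definition below e f : Prop := forall t : R,
  x e.1 <= t -> x f.1 <= t -> t <= x e.2 -> t <= x f.2 -> height e t < height f t.

(** General position enters the counting argument only through the last two
    clauses: edges with a common end are totally ordered by slope. *)
Definition bipartite_geometric E :=
  [/\ {in E, forall e, x e.1 <= z < x e.2},
      {in E &, forall e f, e.1 = f.1 -> slope e = slope f -> e = f} &
      {in E &, forall e f, e.2 = f.2 -> slope e = slope f -> e = f}].

Definition stacked M :=
  {in M &, forall e f, e != f -> below e f \/ below f e}.

Lemma bipartite_geometricS E E' : E' \subset E ->
  bipartite_geometric E -> bipartite_geometric E'.
Proof.
move=> /fintype.subsetP s [h1 h2 h3]; split; first by move=> e /s; exact: h1.
  by move=> e f /s eE /s fE; exact: h2.
by move=> e f /s eE /s fE; exact: h3.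
Qed.

Lemma height_right e t : x e.1 < x e.2 ->
  height e t = y e.2 + slope e * (t - x e.2).
Proof. by move=> h; rewrite /height /slope; field; lra. Qed.

Definition ord (s : bool) (u v : R) := if s then u <= v else v <= u.

Lemma ord_trans s v u w : ord s u v -> ord s v w -> ord s u w.
Proof. by rewrite /ord; case: s => a b; [exact: le_trans a b|exact: le_trans b a]. Qed.

Lemma ord_total u v : ord true u v \/ ord false u v.
Proof. by rewrite /ord; case: (leP u v) => h; [left|right; exact: ltW]. Qed.

(** The two Booleans say in which direction the left and the right ends move,
    so two disjoint edges are comparable for at least one of the four choices. *)
Definition nested (s1 s2 : bool) : rel ('I_n * 'I_n) := fun e f =>
  [&& `[< below e f >], ord s1 (x e.1) (x f.1), ord s2 (x e.2) (x f.2),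
      x e.1 <= z < x e.2 & x f.1 <= z < x f.2].

Lemma nestedP s1 s2 e f : nested s1 s2 e f ->
  [/\ below e f, ord s1 (x e.1) (x f.1) & ord s2 (x e.2) (x f.2)].
Proof. by case/and5P => /asboolP ? ? ? _ _. Qed.

Lemma nested_irr s1 s2 : irreflexive (nested s1 s2).
Proof.
move=> e; apply/negP => h; have [b _ _] := nestedP h.
have /and5P[_ _ _ /andP[h1 /ltW h2] _] := h.
by have := b z h1 h1 h2 h2; rewrite ltxx.
Qed.

(** Of three edges ordered alike, the x-range of the middle one contains the
    common part of the x-ranges of the outer two; this common part contains z. *)
Lemma nested_trans s1 s2 : transitive (nested s1 s2).
Proof.
move=> f e g /and5P[/asboolP b1 o1 o2 h1 h2].
move=> /and5P[/asboolP b2 o3 o4 _ h3].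
apply/and5P; split=> //; [|exact: ord_trans o1 o3|exact: ord_trans o2 o4].
apply/asboolP => t t1 t2 t3 t4.
have t5 : x f.1 <= t by move: o1 o3; rewrite /ord; case: (s1); lra.
have t6 : t <= x f.2 by move: o2 o4; rewrite /ord; case: (s2); lra.
exact: lt_trans (b1 t t1 t5 t3 t6) (b2 t t5 t2 t6 t4).
Qed.

Variables (k : nat) (E : {set 'I_n * 'I_n}).
Hypothesis bE : bipartite_geometric E.
Hypothesis kE : forall M, M \subset E -> stacked M -> (#|M| <= k)%N.

Definition height_rank s1 s2 e := chain_rank (nested s1 s2) E e.

Lemma height_rank_lt s1 s2 e : e \in E -> (height_rank s1 s2 e < k)%N.
Proof.
apply: chain_rank_bound; first exact: nested_irr.
move=> A AE cA; apply: kE => // e' f eA fA /(cA _ _ eA fA) /orP[] /nestedP[]; by [left|right].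
Qed.

(** An edge g below e shares with the turned edge f only abscissas that it also
    shares with e, since the right ends of g, e and f are ordered the same way;
    there f is above e, hence above g. Chains below e stay below f. *)
Lemma height_rank_turn s1 s e f : e \in E -> f \in E -> e.1 = f.1 ->
  slope e < slope f -> ord s (x e.2) (x f.2) ->
  (height_rank s1 s e <= height_rank s1 s f)%N.
Proof.
move=> eE fE ef sl o; apply: leq_chain_rank => g gE /and5P[/asboolP b o1 o2 h1 h2].
have [h _ _] := bE.
apply/and5P; split; rewrite -?ef //; [|exact: ord_trans o2 o|]; last by rewrite ef h.
apply/asboolP => t t1 t2 t3 t4.
have t5 : t <= x e.2 by move: o o2; rewrite /ord; case: (s); lra.
rewrite -ef in t2; apply: lt_le_trans (b t t1 t2 t3 t5) _.
rewrite /height -ef lerD2l; apply: ler_wpM2r; [lra|exact: ltW].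
Qed.

(** The middle edge e separates the outer two: g is strictly below it except at
    its right end, and f strictly above it except at its left end. *)
Lemma below_zigzag e f g : g \in E -> e \in E -> f \in E ->
  g.2 = e.2 -> e.1 = f.1 -> slope e < slope g -> slope e < slope f -> below g f.
Proof.
move=> gE eE fE ge ef s1 s2 t t1 t2 t3 t4.
have [h _ _] := bE; have /andP[g1 g2] := h _ gE; have /andP[e1 e2] := h _ eE.
have /andP[f1 f2] := h _ fE.
have ee : x e.1 < x e.2 by lra.
have gg : x g.1 < x g.2 by lra.
rewrite (height_right t gg) ge /height -ef.
have := height_right t ee; rewrite /height => he.
rewrite -ef in t2; rewrite ge in t3.
case: (ltgtP t (x e.1)) => [| tt |tt]; [lra| |].
  have p1 : 0 < (slope f - slope e) * (t - x e.1) by apply: mulr_gt0; lra.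
  have p2 : 0 <= (slope g - slope e) * (x e.2 - t) by apply: mulr_ge0; lra.
  lra.
have p2 : 0 < (slope g - slope e) * (x e.2 - t) by apply: mulr_gt0; lra.
have p1 : 0 <= (slope f - slope e) * (t - x e.1) by apply: mulr_ge0; lra.
lra.
Qed.

Definition rank_sum s e := (height_rank true s e + height_rank false s e)%N.

(** There are at most k^2 such edges at each right end, one for each pair of
    ranks. Every other edge is the middle edge of ascending zigzags whose first
    edge has the same two ranks. *)
Definition lowest s := [set e in E | ~~ [exists g in E,
  [&& g.2 == e.2, slope e < slope g, height_rank true s g == height_rank true s e &
      height_rank false s g == height_rank false s e]]]%SET.

(** Neither rank decreases by [height_rank_turn]. The first edge g of the zigzag
    is below f and comparable to it for one of the two orders with second
    Boolean s; that rank is the same for g and e, and it increases from g to f. *)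
Lemma rank_sum_turn s e f : e \in E -> f \in E -> e \notin lowest s ->
  e.1 = f.1 -> slope e < slope f -> ord s (x e.2) (x f.2) ->
  (rank_sum s e < rank_sum s f)%N.
Proof.
move=> eE fE; rewrite inE eE negbK => /exists_inP[g gE].
move=> /and4P[/eqP ge sl /eqP r1 /eqP r2] ef sl' o.
have b := below_zigzag gE eE fE ge ef sl sl'.
have [st _ _] := bE.
have t1 := height_rank_turn true eE fE ef sl' o.
have t2 := height_rank_turn false eE fE ef sl' o.
have strict s1 : ord s1 (x g.1) (x f.1) ->
    (height_rank s1 s g < height_rank s1 s f)%N.
  move=> o1; apply: ltn_chain_rank => //; [exact: nested_irr|exact: nested_trans|].
  by apply/and5P; split; rewrite ?st ?ge //; apply/asboolP.
rewrite /rank_sum; case: (ord_total (x g.1) (x f.1)) => /strict lt; lia.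
Qed.

(** A bipartite form of the theorem of Toth that a geometric graph without k + 1
    pairwise disjoint edges has O(k^2 n) edges. Apart from the lowest edges for
    either Boolean, at most 2 k^2 #|V| in number, two edges with a common left
    end differ in one of the two rank sums: the one of larger slope has the
    larger sum for the Boolean that describes how its right end moves. As both
    sums are less than 2 k, at most 4 k^2 edges remain at each left end. *)
Theorem leq_card_no_stack (V : {set 'I_n}) :
  {in E, forall e, e.1 \in V /\ e.2 \in V} -> (#|E| <= 6 * k ^ 2 * #|V|)%N.
Proof.
move=> EV; have [_ b1 b2] := bE.
have low s : (#|lowest s| <= #|V| * (k * k))%N.
  apply: (leq_card_triples (f := snd) (a := height_rank true s) (b := height_rank false s)).
    move=> e; rewrite inE => /andP[eE _]; have [_ ->] := EV e eE.
    by rewrite !height_rank_lt.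
  move=> e f; rewrite !inE => /andP[eE eN] /andP[fE fN] ef r1 r2.
  apply: b2 => //; apply/eqP; case: ltgtP => // sl.
    by case/exists_inP: eN; exists f => //; rewrite sl ef r1 r2 !eqxx.
  by case/exists_inP: fN; exists e => //; rewrite sl ef r1 r2 !eqxx.
pose E' := (E :\: (lowest true :|: lowest false))%SET.
have rest : (#|E'| <= #|V| * (2 * k * (2 * k)))%N.
  apply: (leq_card_triples (f := fst) (a := rank_sum true) (b := rank_sum false)).
    move=> e; rewrite inE => /andP[_ eE]; have [-> _] := EV e eE.
    have bd s : (rank_sum s e < 2 * k)%N.
      have := height_rank_lt true s eE; have := height_rank_lt false s eE.
      by rewrite /rank_sum; lia.
    by rewrite !bd.
  move=> e f /finset.setDP[eE] + /finset.setDP[fE].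
  rewrite !finset.in_setU !negb_or => /andP[eN1 eN2] /andP[fN1 fN2] ef r1 r2.
  apply: b1 => //; apply/eqP; case: ltgtP => // sl.
    by case: (ord_total (x e.2) (x f.2)) => /(rank_sum_turn eE fE) h;
      [have := h eN1 ef sl|have := h eN2 ef sl]; rewrite ?r1 ?r2 ltnn.
  by case: (ord_total (x f.2) (x e.2)) => /(rank_sum_turn fE eE) h;
    [have := h fN1 (esym ef) sl|have := h fN2 (esym ef) sl]; rewrite ?r1 ?r2 ltnn.
have sub : E \subset (E' :|: (lowest true :|: lowest false))%SET.
  by apply/fintype.subsetP => e eE; rewrite finset.in_setU finset.in_setD eE andbT orNb.
have -> : (6 * k ^ 2 * #|V| = #|V| * (2 * k * (2 * k)) + (#|V| * (k * k) + #|V| * (k * k)))%N by ring.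
apply: leq_trans (subset_leq_card sub) _.
apply: leq_trans (leq_of_leqif (leq_card_setU _ _)) _; apply: leq_add => //.
by apply: leq_trans (leq_of_leqif (leq_card_setU _ _)) _; apply: leq_add.
Qed.
End Bipartite.

(** * Covering bipartite graphs by plane matchings, greedily *)

Section StackedCover.
Variables (R : realType) (n : nat) (x y : 'I_n -> R) (z : R) (V : {set 'I_n}).
Implicit Types (E M : {set 'I_n * 'I_n}).

Definition stacked_cover E (c : nat) :=
  exists M : nat -> {set 'I_n * 'I_n},
    (forall i, M i \subset E /\ stacked x y (M i)) /\
    {in E, forall e, exists2 i, (i < c)%N & e \in M i}.

Definition joins E := {in E, forall e, e.1 \in V /\ e.2 \in V}.

Lemma large_stack E j : bipartite_geometric x y z E -> joins E ->
  (6 * j ^ 2 * #|V| < #|E|)%N ->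
  exists M, [/\ M \subset E, stacked x y M & (j < #|M|)%N].
Proof.
move=> bE EV hE; apply: contrapT => no; move: hE; apply/negP; rewrite -leqNgt.
apply: leq_card_no_stack EV => //; first exact: bE.
move=> M ME sM; rewrite leqNgt; apply/negP => h; apply: no; by exists M.
Qed.

(** As long as more than 6 j^2 #|V| edges remain, j + 1 of them can be removed
    at the price of one more matching. *)
Lemma stacked_cover_greedy j c :
  (forall E, bipartite_geometric x y z E -> joins E ->
     (#|E| <= 6 * j ^ 2 * #|V|)%N -> stacked_cover E c) ->
  forall t E, bipartite_geometric x y z E -> joins E ->
    (#|E| <= 6 * j ^ 2 * #|V| + t * j.+1)%N -> stacked_cover E (c + t).
Proof.
move=> h; elim=> [|t IH] E bE EV hE.
  by rewrite addn0; apply: h => //; rewrite mul0n addn0 in hE.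
have [small|large] := leqP #|E| (6 * j ^ 2 * #|V|).
  have [M [MP ME]] := h _ bE EV small; exists M; split=> // e /ME[i ic eM].
  by exists i => //; apply: leq_trans ic (leq_addr _ _).
have [M0 [M0E sM0 jM0]] := large_stack bE EV large.
have DE : (E :\: M0 \subset E)%SET by apply: finset.subsetDl.
have [||M [MP ME]] := IH (E :\: M0)%SET (bipartite_geometricS DE bE).
- by move=> e /(fintype.subsetP DE); apply: EV.
- rewrite cardsD (finset.setIidPr M0E) leq_subLR.
  by apply: leq_trans hE _; rewrite (mulSn t) [leqLHS]addnCA leq_add.
exists (fun i => if i is i'.+1 then M i' else M0); split=> [[|i]|e eE].
- by [].
- by have [s1 s2] := MP i; split=> //; apply: fintype.subset_trans s1 DE.
have [eM0|eM0] := boolP (e \in M0); first by exists 0%N => //; rewrite addnS.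
have [|i ic eM] := ME e; first by rewrite inE eM0.
by exists i.+1 => //; rewrite addnS.
Qed.

(** Each stack of more than j edges that is removed lowers the number of edges
    by j + 1, so 12 #|V| stacks bring it from 6 (j + 1)^2 #|V| down to
    6 j^2 #|V|. *)
Theorem stacked_cover_square j E : bipartite_geometric x y z E -> joins E ->
  (#|E| <= 6 * j ^ 2 * #|V|)%N -> stacked_cover E (12 * #|V| * j).
Proof.
elim: j E => [|j IH] E bE EV hE.
  exists (fun=> finset.set0); split=> [i|e eE].
    by split; [exact: finset.sub0set|move=> e f; rewrite inE].
  have : (0 < #|E|)%N by apply/card_gt0P; exists e.
  by move: hE; rewrite exp0n // muln0 mul0n leqn0 => /eqP ->.
rewrite mulnS addnC; apply: (stacked_cover_greedy IH) => //.
by apply: leq_trans hE _; rewrite !expnS !expn0; nia.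
Qed.
End StackedCover.

(** * Segments, orientations and plane matchings *)

Section PlaneMatchings.
Variables (R : realType) (n : nat) (p : 'I_n -> R * R).
Implicit Types (M : {set {set 'I_n}}) (V : {set 'I_n}) (a b c d : 'I_n).

Definition det (u v w : R * R) : R :=
  (v.1 - u.1) * (w.2 - u.2) - (w.1 - u.1) * (v.2 - u.2).

Lemma collinear_det (u v w : R * R) : det u v w = 0 -> collinear u v w.
Proof.
rewrite /det => h; have [uv|uv] := eqVneq u v.
  rewrite -uv; have [uw|uw] := eqVneq u w.
    exists 1, 0, (u.1); split; first by rewrite xpair_eqE oner_eq0.
    by move=> q; rewrite -uw !inE !orbb => /eqP ->; rewrite mul1r mul0r addr0.
  exists (w.2 - u.2), (u.1 - w.1), ((w.2 - u.2) * u.1 + (u.1 - w.1) * u.2); split.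
    apply/eqP => -[e1 e2]; case/eqP: uw.
    by rewrite [u]surjective_pairing [w]surjective_pairing; congr pair; lra.
  by move=> q; rewrite !inE => /or3P[] /eqP -> //; ring.
exists (v.2 - u.2), (u.1 - v.1), ((v.2 - u.2) * u.1 + (u.1 - v.1) * u.2); split.
  apply/eqP => -[e1 e2]; case/eqP: uv.
  by rewrite [u]surjective_pairing [v]surjective_pairing; congr pair; lra.
by move=> q; rewrite !inE => /or3P[] /eqP -> //; lra.
Qed.

Lemma det_collinear (u v w : R * R) : collinear u v w -> det u v w = 0.
Proof.
move=> [a [b [c [nz h]]]].
have hu := h u (mem_head _ _).
have hv : a * v.1 + b * v.2 = c by apply: h; rewrite !inE eqxx orbT.
have hw : a * w.1 + b * w.2 = c by apply: h; rewrite !inE eqxx !orbT.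
have e1 : a * (v.1 - u.1) = - b * (v.2 - u.2) by lra.
have e2 : a * (w.1 - u.1) = - b * (w.2 - u.2) by lra.
have ha : a * det u v w = 0.
  rewrite /det mulrBr !mulrA e1 e2; ring.
have hb : b * det u v w = 0.
  have -> : b * det u v w = - ((v.1 - u.1) * (- b * (w.2 - u.2)))
    + (w.1 - u.1) * (- b * (v.2 - u.2)) by rewrite /det; ring.
  rewrite -e1 -e2; ring.
apply/eqP; case/boolP: (det u v w == 0) => // d0; case/eqP: nz.
by move/eqP: ha; move/eqP: hb; rewrite !mulf_eq0 (negbTE d0) !orbF => /eqP -> /eqP ->.
Qed.

Definition affine (f : R * R -> R) :=
  exists a b c : R, forall q, f q = a * q.1 + b * q.2 + c.

Lemma affine_segment (f : R * R -> R) (u v : R * R) s : affine f ->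
  f ((1 - s) *: u + s *: v) = (1 - s) * f u + s * f v.
Proof. by move=> [a [b [c h]]]; rewrite !h /= /GRing.scale /=; ring. Qed.

Lemma open_segmentP (u v q : R * R) :
  open_segment u v q <-> exists s : R, [/\ 0 < s, s < 1 & q = (1 - s) *: u + s *: v].
Proof.
split=> [[s /=]|[s [s0 s1 ->]]].
  by rewrite in_itv /= => /andP[s0 s1] <-; exists s.
by exists s => //=; rewrite in_itv /= s0.
Qed.

Lemma open_segmentC (u v : R * R) : open_segment u v `<=` open_segment v u.
Proof.
move=> q /open_segmentP[s [s0 s1 ->]]; apply/open_segmentP; exists (1 - s).
by split; [lra|lra|rewrite addrC; congr (_ *: _ + _); ring].
Qed.

Lemma open_segment_le (f : R * R -> R) (u v q : R * R) r : affine f ->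
  f u <= r -> f v <= r -> open_segment u v q -> f q <= r.
Proof.
move=> af h1 h2 /open_segmentP[s [s0 s1 ->]]; rewrite affine_segment //.
have : 0 <= (1 - s) * (r - f u) by apply: mulr_ge0; lra.
have : 0 <= s * (r - f v) by apply: mulr_ge0; lra.
lra.
Qed.

Lemma open_segment_gt (f : R * R -> R) (u v q : R * R) r : affine f ->
  r < f u -> r < f v -> open_segment u v q -> r < f q.
Proof.
move=> af h1 h2 /open_segmentP[s [s0 s1 ->]]; rewrite affine_segment //.
have : 0 < (1 - s) * (f u - r) by apply: mulr_gt0; lra.
have : 0 < s * (f v - r) by apply: mulr_gt0; lra.
lra.
Qed.

Lemma open_segment_ge (f : R * R -> R) (u v q : R * R) r : affine f ->
  r <= f u -> r <= f v -> open_segment u v q -> r <= f q.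
Proof.
move=> af h1 h2 /open_segmentP[s [s0 s1 ->]]; rewrite affine_segment //.
have : 0 <= (1 - s) * (f u - r) by apply: mulr_ge0; lra.
have : 0 <= s * (f v - r) by apply: mulr_ge0; lra.
lra.
Qed.

Lemma set2_inj a b c d : [set a; b]%SET = [set c; d]%SET ->
  (a = c /\ b = d) \/ (a = d /\ b = c).
Proof.
move=> e.
have /finset.set2P ha : a \in [set c; d]%SET by rewrite -e finset.set21.
have /finset.set2P hb : b \in [set c; d]%SET by rewrite -e finset.set22.
have /finset.set2P hc : c \in [set a; b]%SET by rewrite e finset.set21.
have /finset.set2P hd : d \in [set a; b]%SET by rewrite e finset.set22.
by case: ha hb hc hd => [->|->] [->|->] [|] h1 [|] h2; rewrite ?h1 ?h2; by [left|right].
Qed.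

Lemma edges_cross_set2 a b c d : edges_cross p [set a; b]%SET [set c; d]%SET ->
  (open_segment (p a) (p b) `&` open_segment (p c) (p d) !=set0)%classic.
Proof.
move=> [i [j [k [l [e1 e2 _ [q [q1 q2]]]]]]]; exists q; split.
  by have [[-> ->]|[-> ->]] := set2_inj e1; last exact: open_segmentC.
by have [[-> ->]|[-> ->]] := set2_inj e2; last exact: open_segmentC.
Qed.

(** Being a crossing-free matching is here a condition on pairs of edges, which is
    what makes it local to the cells of [plane_matching_cells]. *)
Definition plane_matching M :=
  M \subset complete_edges n /\
  {in M &, forall e f : {set 'I_n}, e != f -> [disjoint e & f]%B /\ ~ edges_cross p e f}.

Lemma plane_matching_is M : plane_matching M -> is_matching M /\ crossing_free p M.
Proof.
move=> [Mc h]; split; first by split=> // e f eM fM ef; have [] := h e f eM fM ef.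
move=> e f eM fM ec; have ef : e != f by case: ec => [? [? [? [? []]]]].
by have [] := h e f eM fM ef.
Qed.

Lemma complete_edgesP (e : {set 'I_n}) : e \in complete_edges n ->
  exists a b, a != b /\ e = [set a; b]%SET.
Proof. by rewrite inE => /cards2P[a [b [ab ->]]]; exists a, b. Qed.

Lemma complete_edges_set2 a b : a != b -> [set a; b]%SET \in complete_edges n.
Proof. by move=> ab; rewrite inE cards2 ab. Qed.

(** Convexity keeps every edge inside the cell of its ends, so edges in different
    cells do not meet. The cells will be the two sides of a vertical line, or the
    parallel strips of one direction. *)
Lemma plane_matching_cells (C : eqType) (cell : R * R -> C) (Mc : C -> {set {set 'I_n}}) M :
  (forall u v q, cell u = cell v -> open_segment u v q -> cell q = cell u) ->
  (forall c : C, plane_matching (Mc c) /\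
     {in Mc c, forall e : {set 'I_n}, {in e, forall a, cell (p a) = c}}) ->
  {in M, forall e : {set 'I_n}, exists c : C, e \in Mc c} -> plane_matching M.
Proof.
move=> cvx hMc hM; split.
  apply/fintype.subsetP => e /hM[c eMc]; have [[/fintype.subsetP s _] _] := hMc c; exact: s.
move=> e f /hM[c eMc] /hM[c' fMc] ef.
have [[sc hc] inc] := hMc c; have [[sc' hc'] inc'] := hMc c'.
have [cc|cc] := eqVneq c c'; first by apply: hc => //; rewrite cc.
have ie := inc _ eMc; have if' := inc' _ fMc; split.
  rewrite -setI_eq0; apply/eqP/setP => a; rewrite !inE; apply/negP => /andP[/ie h1 /if' h2].
  by case/eqP: cc; rewrite -h1 h2.
have [a [b [_ eab]]] := complete_edgesP (fintype.subsetP sc _ eMc).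
have [a' [b' [_ fab]]] := complete_edgesP (fintype.subsetP sc' _ fMc).
move: ie if'; rewrite eab fab => ie if' /edges_cross_set2[q [q1 q2]].
have ha : cell (p a) = c by apply: ie; rewrite !inE eqxx.
have hb : cell (p b) = c by apply: ie; rewrite !inE eqxx orbT.
have ha' : cell (p a') = c' by apply: if'; rewrite !inE eqxx.
have hb' : cell (p b') = c' by apply: if'; rewrite !inE eqxx orbT.
case/eqP: cc; rewrite -ha -(cvx _ _ _ _ q1) ?ha //.
by rewrite -ha' -(cvx _ _ _ _ q2) ?ha'.
Qed.
End PlaneMatchings.

(** * Covering a complete geometric graph on m points by O(m^(3/2)) plane matchings *)

Section CompleteMatchings.
Variables (R : realType) (n : nat) (p : 'I_n -> R * R) (t : R).
Hypothesis gp : general_position p.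
Implicit Types (V L : {set 'I_n}) (a b c d : 'I_n).

(** Abscissas are measured after a shear, chosen in [generic_shear] so that no two
    points have the same one. *)
Definition shear (q : R * R) : R := q.1 + t * q.2.

Let x i := shear (p i).
Let y i := (p i).2.

Lemma affine_shear : affine shear.
Proof. by exists 1, t, 0 => q; rewrite /shear; ring. Qed.

Lemma general_position_det a b c : det (p a) (p b) (p c) = 0 ->
  [\/ a = b, b = c | a = c].
Proof.
move=> h; have [->|ab] := eqVneq a b; first by constructor 1.
have [->|bc] := eqVneq b c; first by constructor 2.
have [->|ac] := eqVneq a c; first by constructor 3.
by case: (gp.2 _ _ _ ab bc ac); exact: collinear_det.
Qed.

Lemma height_segment a b q : x a < x b -> open_segment (p a) (p b) q ->
  [/\ x a < shear q, shear q < x b & q.2 = height x y (a, b) (shear q)].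
Proof.
move=> ab /open_segmentP[s [s0 s1 qE]].
have hq : shear q = (1 - s) * x a + s * x b.
  by rewrite qE (affine_segment _ _ _ affine_shear).
have s2 : 0 < s * (x b - x a) by apply: mulr_gt0; lra.
have s3 : 0 < (1 - s) * (x b - x a) by apply: mulr_gt0; lra.
split; [lra|lra|].
rewrite /height /slope hq qE /= /GRing.scale /= -/(y a) -/(y b); field; lra.
Qed.

Section LeftRight.
Variables (L L' : {set 'I_n}) (z : R).
Hypothesis Lz : {in L, forall a, x a <= z}.
Hypothesis L'z : {in L', forall b, z < x b}.

Lemma bipartite_general_position : bipartite_geometric x y z (finset.setX L L').
Proof.
split.
- by move=> [a b] /finset.setXP[/= /Lz -> /L'z ->].
- move=> [a b] [c d] /finset.setXP[/= aL bL] /finset.setXP[/= cL dL] e; subst c.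
  have := Lz aL; have := L'z bL; have := L'z dL => h1 h2 h3.
  rewrite /slope /= => /eqP; rewrite eqr_div; [|lra|lra] => /eqP h.
  have : det (p a) (p b) (p d) = 0 by move: h; rewrite /det /x /y /shear; lra.
  case/general_position_det => [ab|->//|ad].
    by exfalso; rewrite ab in h3; lra.
  by exfalso; rewrite ad in h3; lra.
- move=> [a b] [c d] /finset.setXP[/= aL bL] /finset.setXP[/= cL dL] e; subst d.
  have := Lz aL; have := L'z bL; have := Lz cL => h1 h2 h3.
  rewrite /slope /= => /eqP; rewrite eqr_div; [|lra|lra] => /eqP h.
  have : det (p a) (p b) (p c) = 0 by move: h; rewrite /det /x /y /shear; lra.
  case/general_position_det => [ab|bc|->//].
    by exfalso; rewrite ab in h3; lra.
  by exfalso; rewrite bc in h2; lra.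
Qed.

Lemma below_apart a b c d : a \in L -> b \in L' -> c \in L -> d \in L' ->
  below x y (a, b) (c, d) ->
  [disjoint [set a; b]%SET & [set c; d]%SET]%B /\
  ~ edges_cross p [set a; b]%SET [set c; d]%SET.
Proof.
move=> /Lz aL /L'z bL /Lz cL /L'z dL h.
have ab : x a < x b by lra.
have cd : x c < x d by lra.
split.
  rewrite -setI_eq0; apply/eqP/setP => v; rewrite !inE; apply/negP.
  case/andP => /orP[]/eqP -> /orP[]/eqP E.
  - subst c; have := h (x a) (lexx _) (lexx _) (ltW ab) (ltW cd).
    by rewrite /height subrr !mulr0 ltxx.
  - by rewrite E in aL; lra.
  - by rewrite E in bL; lra.
  - subst d; have := h (x b) (ltW ab) (ltW cd) (lexx _) (lexx _).
    by rewrite !height_right // subrr !mulr0 ltxx.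
move=> /edges_cross_set2[q [/(height_segment ab)[h1 h2 h3] /(height_segment cd)[h4 h5 h6]]].
have := h (shear q) (ltW h1) (ltW h4) (ltW h2) (ltW h5).
by rewrite -h3 -h6 ltxx.
Qed.

Definition edges_of (M : {set 'I_n * 'I_n}) : {set {set 'I_n}} :=
  [set [set e.1; e.2] | e in M]%SET.

Lemma stacked_plane_matching (M : {set 'I_n * 'I_n}) : M \subset finset.setX L L' ->
  stacked x y M -> plane_matching p (edges_of M).
Proof.
move=> /fintype.subsetP ML sM; split.
  apply/fintype.subsetP => _ /imsetP[[a b] /ML/finset.setXP[/= /Lz h1 /L'z h2] ->].
  apply: complete_edges_set2; apply/eqP => E; rewrite E in h1; lra.
move=> _ _ /imsetP[[a b] eM ->] /imsetP[[c d] fM ->] ef.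
have /finset.setXP[/= aL bL] := ML _ eM; have /finset.setXP[/= cL dL] := ML _ fM.
have ne : (a, b) != (c, d) by apply/eqP => -[E1 E2]; move: ef; rewrite E1 E2 eqxx.
have [|/(below_apart cL dL aL bL)[h1 h2]] := sM _ _ eM fM ne; first exact: below_apart.
split; first by rewrite disjoint_sym.
move=> /edges_cross_set2[q [q1 q2]]; apply: h2.
by exists c, d, a, b; split=> //=; [rewrite eq_sym|exists q].
Qed.
End LeftRight.

(** Matchings are numbered, rather than collected in a set, so that those on the
    two sides of a vertical line can be united number by number. *)
Definition matchable V (c : nat) :=
  exists M : nat -> {set {set 'I_n}},
    (forall i, plane_matching p (M i) /\ {in M i, forall e : {set 'I_n}, e \subset V}) /\
    {in V &, forall a b, a != b -> exists2 i, (i < c)%N & [set a; b]%SET \in M i}.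

Hypothesis xI : injective x.

Lemma halve_set V (N : nat) : (#|V| <= 2 * N)%N ->
  exists L L' z, [/\ V = L :|: L', (#|L| <= N)%N /\ (#|L'| <= N)%N,
    {in L, forall a, x a <= z} & {in L', forall b, z < x b}].
Proof.
move=> VN; pose s := sort (fun a b => x a <= x b) (enum V).
have ss : sorted (fun a b => x a <= x b) s by apply: sort_sorted => a b; exact: le_total.
have us : uniq s by rewrite sort_uniq enum_uniq.
have ms v : (v \in s) = (v \in V) by rewrite mem_sort mem_enum.
have zs : size s = #|V| by rewrite size_sort -cardE.
have tr : transitive (fun a b => x a <= x b) by move=> ? ? ?; exact: le_trans.
have us' : uniq (take N s ++ drop N s) by rewrite cat_take_drop.
have lt : {in take N s & drop N s, forall a b, x a < x b}.
  move=> a b aT bD; rewrite lt_neqAle; apply/andP; split.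
    apply/eqP => /xI ab; move: us'; rewrite cat_uniq => /and3P[_ /hasPn/(_ _ bD)].
    by rewrite /= -ab aT.
  have := sorted_pairwise tr s; rewrite ss => /esym; rewrite -{1}(cat_take_drop N s).
  by rewrite pairwise_cat => /and3P[/allrelP h _ _]; exact: (h a b aT bD).
pose L := [set a in take N s]%SET; pose L' := [set a in drop N s]%SET.
have VE : V = L :|: L' by apply/setP => v; rewrite !inE -mem_cat cat_take_drop ms.
have cL : (#|L| <= N)%N.
  by rewrite cardsE (leq_trans (card_size _)) // size_take; case: ltnP.
have cL' : (#|L'| <= N)%N.
  by rewrite cardsE (leq_trans (card_size _)) // size_drop zs leq_subLR addnn -mul2n.
have [L0|/finset.set0Pn[v0 v0L]] := eqVneq L finset.set0.
  exists L, L', 0; split=> //; first by move=> a; rewrite L0 inE.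
  move=> b; rewrite inE => bD; exfalso.
  have : take N s = [::].
    by case E: (take N s) => [//|v s']; have := finset.in_set0 v; rewrite -L0 inE E mem_head.
  move/(congr1 size); rewrite size_take.
  have : (0 < size s)%N by case: (s) bD => //; rewrite drop_nil.
  rewrite zs /=; case: (ltnP N) => _ h2 h3; last by rewrite h3 in h2.
  by move: VN; rewrite h3 muln0 leqNgt h2.
case: (arg_maxP (P := mem L) (fun v => x v) v0L) => v vL vmax.
exists L, L', (x v); split=> // b bL'; apply: lt; first by have : v \in L := vL; rewrite inE.
by move: bL'; rewrite inE.
Qed.

(** The two halves use the same c matchings in parallel; only the edges that join
    them need new ones. *)
Lemma matchable_double (N c J : nat) : (forall V, (#|V| <= N)%N -> matchable V c) ->
  (2 * N <= J ^ 2)%N ->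
  forall V, (#|V| <= 2 * N)%N -> matchable V (c + 12 * (2 * N) * J).
Proof.
move=> IH NJ V VN; have [L [L' [z [VE [LN L'N] Lz L'z]]]] := halve_set VN.
have [ML [hL cL]] := IH _ LN; have [MR [hR cR]] := IH _ L'N.
have bE := bipartite_general_position Lz L'z.
have jE : joins V (finset.setX L L').
  by move=> [a b] /finset.setXP[/= aL bL]; rewrite VE !inE aL bL orbT.
have cE : (#|finset.setX L L'| <= 6 * J ^ 2 * #|V|)%N.
  have LV : (#|L| <= #|V|)%N by apply: subset_leq_card; rewrite VE finset.subsetUl.
  by rewrite cardsX; nia.
have [MB [hB cB]] := stacked_cover_square bE jE cE.
exists (fun i => if (i < c)%N then ML i :|: MR i else edges_of (MB (i - c)%N)); split.
  move=> i; case: ltnP => ic.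
    split; last first.
      move=> e; rewrite inE => /orP[/(hL i).2|/(hR i).2] h; rewrite VE.
        exact: fintype.subset_trans h (finset.subsetUl _ _).
      exact: fintype.subset_trans h (finset.subsetUr _ _).
    refine (@plane_matching_cells _ _ _ bool (fun q => shear q <= z)
      (fun s : bool => if s then ML i else MR i) _ _ _ _).
    - move=> u v q; case: (leP (shear u) z) => hu; case: (leP (shear v) z) => hv // _ sq.
        have := open_segment_le affine_shear hu hv sq; by [].
      by apply/negbTE; rewrite -ltNge; exact: open_segment_gt affine_shear hu hv sq.
    - case; [have [h1 h2] := hL i|have [h1 h2] := hR i]; split=> // e /h2/fintype.subsetP h a /h.
        exact: Lz.
      by move/L'z => h'; apply/negbTE; rewrite -ltNge.
    - move=> e; rewrite inE => /orP[] h; first by exists true.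
      exists false; exact: h.
  have [s1 s2] := hB (i - c)%N; split; first exact: (stacked_plane_matching Lz L'z s1 s2).
  move=> _ /imsetP[[a b] /(fintype.subsetP s1)/finset.setXP[/= aL bL] ->].
  by rewrite finset.subUset !finset.sub1set VE !inE aL bL orbT.
have cross a b : a \in L -> b \in L' ->
    exists2 i, (i < c + 12 * (2 * N) * J)%N & [set a; b]%SET \in
      (if (i < c)%N then ML i :|: MR i else edges_of (MB (i - c)%N)).
  move=> aL bL; have [|i ic iM] := cB (a, b); first by rewrite inE /= aL bL.
  exists (c + i)%N; first by rewrite ltn_add2l (leq_trans ic) // leq_mul2r leq_mul2l VN !orbT.
  by rewrite ltnNge leq_addr /= addKn; apply/imsetP; exists (a, b).
have wk i : (i < c)%N -> (i < c + 12 * (2 * N) * J)%N by move=> h; rewrite ltn_addr.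
move=> a b; rewrite VE => /finset.setUP[aL|aL] /finset.setUP[bL|bL] ab.
- have [i ic h] := cL a b aL bL ab; exists i; first exact: wk.
  by rewrite ic inE h.
- exact: cross.
- by have [i ic h] := cross b a bL aL; exists i => //; rewrite finset.setUC.
- have [i ic h] := cR a b aL bL ab; exists i; first exact: wk.
  by rewrite ic inE h orbT.
Qed.

(** Two rounds of halving quarter the number of points and cost 48 * 8^s and
    96 * 8^s matchings; 21 is the least constant c with c + 144 <= 8 c. *)
Lemma matchable_pow4 s V : (#|V| <= 4 ^ s)%N -> matchable V (21 * 8 ^ s).
Proof.
elim: s V => [|s IH] V hV.
  exists (fun=> finset.set0); split.
    move=> i; split; last by move=> e; rewrite inE.
    by split; [exact: finset.sub0set|move=> e f; rewrite inE].
  move=> a b aV bV /eqP[]; have /cards1P : #|V| == 1%N.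
    rewrite eqn_leq hV; apply/card_gt0P; by exists a.
  by case=> v E; move: aV bV; rewrite E !inE => /eqP -> /eqP ->.
have e4 : (4 ^ s = 2 ^ s * 2 ^ s)%N by rewrite -expnMn.
have e8 : (8 ^ s = 2 ^ s * 2 ^ s * 2 ^ s)%N by rewrite -!expnMn.
have J2 : (2 * (2 * 4 ^ s) <= (2 ^ s.+1) ^ 2)%N.
  by rewrite e4 (expnS 2 s) -mulnn leq_eqVlt; apply/orP; left; apply/eqP; ring.
have J1 : (2 * 4 ^ s <= (2 ^ s.+1) ^ 2)%N by apply: leq_trans J2; nia.
have hV' : (#|V| <= 2 * (2 * 4 ^ s))%N by move: hV; rewrite expnS mulnA.
have [M [M1 M2]] := matchable_double (matchable_double IH J1) J2 hV'.
exists M; split=> // a b aV bV ab; have [i ic h] := M2 a b aV bV ab.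
exists i => //; apply: leq_trans ic _.
by rewrite !expnS e4 e8; nia.
Qed.
End CompleteMatchings.

(** * Covers built from families of parallel strips *)

Section CoverByFamily.
Variables (R : realType) (n : nat).

Lemma covered_by_family (I : finType) (F : I -> {set {set 'I_n}}) (c : R)
    (Q : {set {set 'I_n}} -> Prop) : #|I|%:R <= c ->
  (forall a b : 'I_n, a != b -> exists i, Q (F i) /\ [set a; b]%SET \in F i) ->
  covered_by_at_most c Q.
Proof.
move=> Ic h; exists [set F i | i in [pred i | `[< Q (F i) >]]]%SET; split.
- by apply: le_trans Ic; rewrite ler_nat (leq_trans (leq_imset_card _ _)) // max_card.
- by move=> E /imsetP[i]; rewrite inE => hq ->.
apply/fintype.subsetP => e /complete_edgesP[a [b [ab ->]]].
have [i [Qi ei]] := h a b ab.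
apply/bigcupP; exists (F i) => //; apply/imsetP; exists i => //.
by rewrite inE.
Qed.

Lemma walk_edgesP (v : 'I_n) (s : seq 'I_n) (e : {set 'I_n}) :
  reflect (exists2 i, (i.+1 < size s)%N & e = [set nth v s i; nth v s i.+1]%SET)
          (e \in walk_edges s).
Proof.
rewrite /walk_edges inE; apply: (iffP mapP) => [[u us ->]|[i si ->]].
  have [i si <-] := nthP (v, v) us.
  rewrite nth_zip_cond si; move: si; rewrite size_zip size_behead leq_min ltn_predRL => /andP[_ si].
  exists i => //.
  by rewrite /= nth_behead.
have zs : (i < size (zip s (behead s)))%N.
  by rewrite size_zip size_behead leq_min ltn_predRL si ltnW.
exists (nth (v, v) (zip s (behead s)) i); first exact: mem_nth.
by rewrite nth_zip_cond zs /= nth_behead.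
Qed.

End CoverByFamily.

Section MonotonePaths.
Variables (R : realType) (n : nat) (p : 'I_n -> R * R).
Hypothesis gp : general_position p.

Definition nonconstant_affine (f : R * R -> R) := exists a b c : R,
  (a, b) != (0, 0) /\ forall q, f q = a * q.1 + b * q.2 + c.

Lemma nonconstant_affine_affine f : nonconstant_affine f -> affine f.
Proof. by move=> [a [b [c [_ h]]]]; exists a, b, c. Qed.

Lemma level_collinear (f : R * R -> R) (u v w : R * R) : nonconstant_affine f -> f u = f v -> f u = f w ->
  collinear u v w.
Proof.
move=> [a [b [c [ab h]]]]; rewrite !h => uv uw.
exists a, b, (a * u.1 + b * u.2); split=> // q.
by rewrite !inE => /or3P[] /eqP ->; lra.
Qed.

Lemma segment_top (f : R * R -> R) (u v q : R * R) : affine f -> f u <= f v ->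
  open_segment u v q -> f q <= f v /\ (f q = f v -> f u = f v).
Proof.
move=> af uv /open_segmentP[s [s0 s1 ->]]; rewrite affine_segment //.
have [uv'|uv'] := eqVneq (f u) (f v); first by rewrite uv'; split => //; lra.
have : 0 < (1 - s) * (f v - f u) by apply: mulr_gt0; [lra|rewrite subr_gt0 lt_neqAle uv'].
by move=> h; split=> [|e]; lra.
Qed.

Lemma segment_bottom (f : R * R -> R) (u v q : R * R) : affine f -> f u <= f v -> open_segment u v q ->
  f u <= f q /\ (f q = f u -> f u = f v).
Proof.
move=> af uv /open_segmentP[s [s0 s1 ->]]; rewrite affine_segment //.
have [uv'|uv'] := eqVneq (f u) (f v); first by rewrite uv'; split => //; lra.
have : 0 < s * (f v - f u) by apply: mulr_gt0; [lra|rewrite subr_gt0 lt_neqAle uv'].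
by move=> h; split=> [|e]; lra.
Qed.

(** Two edges of the walk have their f-ranges in consecutive intervals, so they can
    only meet at a common end of these intervals; then both edges are level
    for f, and three points of the walk are collinear. *)
Lemma monotone_walk_crossing_free (f : R * R -> R) (s : seq 'I_n) : nonconstant_affine f -> uniq s ->
  sorted (fun a b => f (p a) <= f (p b)) s -> crossing_free p (walk_edges s).
Proof.
move=> nf us ss.
have af := nonconstant_affine_affine nf.
have tr : transitive (fun a b => f (p a) <= f (p b)) by move=> ? ? ?; exact: le_trans.
case: s us ss => [|v s] us ss e g; first by rewrite inE.
move: (v :: s) us ss => {}s us ss /(walk_edgesP v)[i si eE] /(walk_edgesP v)[j sj gE] eg.
have le i1 j1 : (i1 <= j1)%N -> (j1 < size s)%N -> f (p (nth v s i1)) <= f (p (nth v s j1)).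
  move=> ij js; apply: (sorted_leq_nth tr _ v ss) => //.
  by rewrite inE (leq_ltn_trans ij).
have noncol i1 j1 k1 : (i1 < j1)%N -> (j1 < k1)%N -> (k1 < size s)%N ->
    f (p (nth v s i1)) = f (p (nth v s j1)) -> f (p (nth v s i1)) = f (p (nth v s k1)) -> False.
  move=> ij jk ks e1 e2; have js := ltn_trans jk ks; have is_ := ltn_trans ij js.
  apply: (gp.2 (nth v s i1) (nth v s j1) (nth v s k1)) (level_collinear nf e1 e2);
    rewrite nth_uniq // neq_ltn ?ij ?jk //.
  by rewrite (ltn_trans ij jk).
have main i1 j1 : (i1 < j1)%N -> (j1.+1 < size s)%N ->
  (open_segment (p (nth v s i1)) (p (nth v s i1.+1)) `&`
   open_segment (p (nth v s j1)) (p (nth v s j1.+1)) !=set0)%classic -> False.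
  move=> ij js [q [q1 q2]].
  have [h1 h2] := segment_top af (le _ _ (leqnSn i1) (ltn_trans (ij : (i1.+1 < j1.+1)%N) js)) q1.
  have [h3 h4] := segment_bottom af (le _ _ (leqnSn j1) js) q2.
  have h5 := le _ _ ij (ltnW js).
  have h6 : f q = f (p (nth v s i1.+1)) by lra.
  have h7 : f q = f (p (nth v s j1)) by lra.
  have h8 := h2 h6; have h9 := h4 h7.
  by apply: (noncol i1 i1.+1 j1.+1) => //; lra.
rewrite eE gE in eg; have := edges_cross_set2 eg; case: (ltngtP i j) => [ij|ji|ij].
- exact: main.
- by move=> [q [q1 q2]]; apply: (main j i) => //; exists q.
- by case: eg => [? [? [? [? [_ _]]]]]; rewrite ij eqxx.
Qed.

(** A vertex visited between a and b has its f-value between theirs. *)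
Lemma mem_monotone_walk (f : R * R -> R) (s : seq 'I_n) a b : uniq s ->
  sorted (fun a b => f (p a) <= f (p b)) s -> a \in s -> b \in s -> a != b ->
  (forall w, w \in s -> f (p a) <= f (p w) <= f (p b) -> w = a \/ w = b) ->
  (forall w, w \in s -> f (p b) <= f (p w) <= f (p a) -> w = a \/ w = b) ->
  [set a; b]%SET \in walk_edges s.
Proof.
move=> us ss.
have tr : transitive (fun a b => f (p a) <= f (p b)) by move=> ? ? ?; exact: le_trans.
have le i1 j1 : (i1 <= j1)%N -> (j1 < size s)%N -> f (p (nth a s i1)) <= f (p (nth a s j1)).
  move=> ij js; apply: (sorted_leq_nth tr _ a ss) => //.
  by rewrite inE (leq_ltn_trans ij).
have main c d : c \in s -> d \in s -> (index c s < index d s)%N ->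
    (forall w, w \in s -> f (p c) <= f (p w) <= f (p d) -> w = c \/ w = d) ->
    [set c; d]%SET \in walk_edges s.
  move=> cs ds cd h; apply/(walk_edgesP a); exists (index c s).
    by rewrite (leq_ltn_trans cd) // index_mem.
  have ids : (index d s < size s)%N by rewrite index_mem.
  have ws := leq_ltn_trans cd ids.
  have cw : f (p c) <= f (p (nth a s (index c s).+1)).
    by rewrite -{1}(nth_index a cs) le.
  have wd : f (p (nth a s (index c s).+1)) <= f (p d).
    by rewrite -{1}(nth_index a ds) le.
  have [|E|E] := h _ (mem_nth a ws); first by rewrite cw.
    have : index c s = (index c s).+1 by rewrite -{1}E index_uniq.
    by lia.
  by rewrite nth_index // E.
move=> as_ bs ab h1 h2; case: (ltngtP (index a s) (index b s)) => [lt|lt|E].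
- exact: main.
- rewrite finset.setUC; apply: main => // w ws wab.
  by case: (h2 w ws wab) => ->; [right|left].
- by case/eqP: ab; rewrite -(nth_index a as_) E nth_index.
Qed.
End MonotonePaths.

Section Strips.
Variables (R : realType) (n : nat) (p : 'I_n -> R * R).
Hypothesis gp : general_position p.

(** Each pair of points forbids at most one shear. *)
Lemma generic_shear : exists t : R, injective (fun i => shear t (p i)).
Proof.
pose bad (u : 'I_n * 'I_n) := - ((p u.1).1 - (p u.2).1) / ((p u.1).2 - (p u.2).2).
(* a value larger than all the forbidden ones *)
exists (1 + \sum_u `|bad u|) => i j.
rewrite /shear; set t := 1 + _ => e; apply: gp.1.
have ht : bad (i, j) < t.
  apply: le_lt_trans (ler_norm _) _; rewrite /t (bigD1 (i, j)) //=.
  have : 0 <= \sum_(u | u != (i, j)) `|bad u| by apply: sumr_ge0.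
  lra.
have [e2|ne] := eqVneq (p i).2 (p j).2.
  rewrite [p i]surjective_pairing [p j]surjective_pairing; congr pair => //.
  by move: e; rewrite e2; lra.
have : bad (i, j) = t.
  have ne' : (p i).2 - (p j).2 != 0 by rewrite subr_eq0.
  apply: (mulIf ne'); rewrite /bad /= mulfVK //; move: e; set u := t; lra.
by move=> E; rewrite E ltxx in ht.
Qed.

Variables (D : finType) (f : D -> R * R -> R) (s : nat).
Hypothesis nf : forall d, nonconstant_affine (f d).

Definition strip d (i : 'I_n) : int := Num.floor (f d (p i)).
Definition strip_set d (c : int) := [set i | strip d i == c]%SET.

Hypothesis thin : forall d c, (#|strip_set d c| <= 4 ^ s)%N.
Hypothesis pairs : forall i j, exists d, strip d i = strip d j.

Lemma floor_slab (u v q : R) : u <= q <= v -> Num.floor u = Num.floor v ->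
  Num.floor q = Num.floor u.
Proof.
move=> /andP[uq qv] uv; apply: floor_def.
have /andP[h1 _] := floor_itv u; have /andP[_ h2] := floor_itv v.
by rewrite (le_trans h1 uq) (le_lt_trans qv) // uv.
Qed.

(** An injective numbering of the points of each strip; the order of the labels
    has no geometric meaning. *)
Definition strip_rank d (i : 'I_n) := #|[set j in strip_set d (strip d i) | (j < i)%N]|%SET.

Lemma strip_rank_inj d i j : strip d i = strip d j -> strip_rank d i = strip_rank d j -> i = j.
Proof.
have lt a b : strip d a = strip d b -> (a < b)%N -> (strip_rank d a < strip_rank d b)%N.
  move=> e ab; apply: proper_card; apply/properP; split.
    apply/fintype.subsetP => v; rewrite !inE e => /andP[-> va].
    exact: ltn_trans va ab.
  by exists a; rewrite !inE e eqxx ?ab ?ltnn.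
move=> e r; apply/eqP; rewrite -(inj_eq val_inj) /=; case: ltngtP => // h.
  by have := lt _ _ e h; rewrite r ltnn.
by have := lt _ _ (esym e) h; rewrite r ltnn.
Qed.

Lemma strip_rank_lt d i : (strip_rank d i < 4 ^ s)%N.
Proof.
apply: leq_trans (thin d (strip d i)); apply: proper_card; apply/properP; split.
  by apply/fintype.subsetP => v; rewrite inE => /andP[].
by exists i; rewrite !inE ?eqxx ?ltnn.
Qed.

(** For a direction and two ranks, take the at most two points with these ranks
    in each strip, and visit them all in the order transverse to the strips. *)
Let strip_path (x : D * ('I_(4 ^ s) * 'I_(4 ^ s))) : seq 'I_n :=
  sort (fun a b => f x.1 (p a) <= f x.1 (p b))
    (enum [set i | (strip_rank x.1 i == x.2.1) || (strip_rank x.1 i == x.2.2)]%SET).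

(** A pair in a common strip is consecutive on the path given by its two ranks:
    any point visited in between is in the same strip and has one of their ranks. *)
Theorem strips_path_cover (c : R) : (#|D| * (4 ^ s * 4 ^ s))%:R <= c ->
  covered_by_at_most c (fun E => is_path E /\ crossing_free p E).
Proof.
move=> hc; apply: (@covered_by_family _ _ _ (fun x => walk_edges (strip_path x))).
  by rewrite !card_prod !card_ord.
move=> a b ab; have [d dab] := pairs a b.
pose x := (d, (Ordinal (strip_rank_lt d a), Ordinal (strip_rank_lt d b))).
have us : uniq (strip_path x) by rewrite sort_uniq enum_uniq.
have ss : sorted (fun a b => f d (p a) <= f d (p b)) (strip_path x).
  by apply: sort_sorted => u v; exact: le_total.
have ms v : (v \in strip_path x) = (strip_rank d v == strip_rank d a) || (strip_rank d v == strip_rank d b).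
  by rewrite mem_sort mem_enum inE.
have as_ : a \in strip_path x by rewrite ms eqxx.
have slab w : w \in strip_path x -> strip d w = strip d a -> w = a \/ w = b.
  rewrite ms => /orP[/eqP|/eqP] r wa; [left|right]; apply: strip_rank_inj r => //.
  by rewrite wa.
exists x; split; last first.
  apply: (mem_monotone_walk us ss) => //; first by rewrite ms eqxx orbT.
  - by move=> w ws h; apply: slab => //; exact: floor_slab h dab.
  - by move=> w ws h; apply: slab => //; rewrite dab; exact: floor_slab h (esym dab).
split; last exact: monotone_walk_crossing_free (nf d) us ss.
by move: us as_; case: (strip_path x) => // v t us _; exists v, t.
Qed.

(** All strips of one direction are treated in parallel, the i-th matchings of the
    complete graphs on their points forming one plane matching. *)
Theorem strips_matching_cover (c : R) : (#|D| * (21 * 8 ^ s))%:R <= c ->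
  covered_by_at_most c (fun E => is_matching E /\ crossing_free p E).
Proof.
move=> hc; have [t tI] := generic_shear.
have /choice[M hM] : forall x : D * int, exists M : nat -> {set {set 'I_n}},
    (forall i, plane_matching p (M i) /\
      {in M i, forall e : {set 'I_n}, e \subset strip_set x.1 x.2}) /\
    {in strip_set x.1 x.2 &, forall a b, a != b ->
      exists2 i, (i < 21 * 8 ^ s)%N & [set a; b]%SET \in M i}.
  by move=> [d z]; apply: (matchable_pow4 gp tI); exact: thin.
pose U (x : D * 'I_(21 * 8 ^ s)) := (\bigcup_(i : 'I_n) M (x.1, strip x.1 i) x.2)%SET.
apply: (@covered_by_family _ _ _ U); first by rewrite card_prod card_ord.
move=> a b ab; have [d dab] := pairs a b.
have [_ cv] := hM (d, strip d a).
have [||i ic iM] := cv a b _ _ ab; rewrite ?inE ?dab //=.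
exists (d, Ordinal ic); split; last by apply/finset.bigcupP; exists a.
apply: plane_matching_is.
apply: (@plane_matching_cells _ _ _ int (fun q => Num.floor (f d q)) (fun z => M (d, z) i)).
- move=> u v q uv sq; have af := nonconstant_affine_affine (nf d).
  wlog le : u v uv sq / f d u <= f d v.
    move=> h; have [le|/ltW le] := leP (f d u) (f d v); first exact: (h u v uv sq le).
    by rewrite uv; apply: (h v u (esym uv) _ le); exact: open_segmentC.
  apply: (@floor_slab _ (f d v)) => //; apply/andP; split.
    exact: open_segment_ge af (lexx _) le sq.
  exact: open_segment_le af le (lexx _) sq.
- move=> z; have [h _] := hM (d, z); have [h1 h2] := h i; split=> // e /h2/fintype.subsetP h3 v /h3.
  by rewrite inE => /eqP.
- by move=> e /bigcupP[v _ eM]; exists (strip d v).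
Qed.
End Strips.

(** * The family of strips *)

Lemma int_range (K : nat) (z : int) : - K%:Z <= z -> z < K%:Z + 1 ->
  exists i : 'I_(2 * K).+1, z = i%:Z - K%:Z.
Proof.
move=> h1 h2; have ub : (absz (z + K%:Z)%R < (2 * K).+1)%N by lia.
by exists (Ordinal ub) => /=; lia.
Qed.

Section StripFamily.
Variables (R : realType) (K : nat).
Hypothesis K0 : (0 < K)%N.

Definition swap_if (s : bool) (q : R * R) : R * R := if s then (q.2, q.1) else q.

Definition strip_index := (bool * ('I_(2 * K).+1 * bool))%type.

(** The level lines have slope j / K, with -K <= j <= K, over one of the two axes.
    The strips on which the floor is constant have width 2 / K along the other
    axis, and the last Boolean shifts them by half of this width. *)
Definition strip_form (d : strip_index) (q : R * R) : R :=
  (K%:R * (swap_if d.1 q).2 - (d.2.1%:R - K%:R) * (swap_if d.1 q).1 + d.2.2%:R) / 2.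

Let KR : 0 < K%:R :> R. Proof. by rewrite ltr0n. Qed.

Lemma strip_form_affine d : nonconstant_affine (strip_form d).
Proof.
case: d => -[] [k e].
  exists (K%:R / 2), (- (k%:R - K%:R) / 2), (e%:R / 2); split.
    by apply/eqP => -[h _]; have := KR; lra.
  by move=> q; rewrite /strip_form /=; field.
exists (- (k%:R - K%:R) / 2), (K%:R / 2), (e%:R / 2); split.
  by apply/eqP => -[_ h]; have := KR; lra.
by move=> q; rewrite /strip_form /=; field.
Qed.

(** Half-open intervals of length 1 meet at most one integer, hence lie in one
    cell of one of the two shifted partitions into intervals of length 2. *)
Lemma common_half_floor (t0 : R) : exists (e : bool) (m : int),
  forall t, t0 <= t < t0 + 1 -> Num.floor ((t + e%:R) / 2) = m.
Proof.
pose m := Num.floor (t0 / 2); have /andP[h1 h2] := floor_itv (t0 / 2).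
rewrite -/m intrD in h1 h2.
have [h|h] := ltP t0 (2 * m%:~R + 1).
  by exists false, m => t /andP[h3 h4]; apply: floor_def; rewrite intrD /=; lra.
by exists true, (m + 1) => t /andP[h3 h4]; apply: floor_def; rewrite !intrD /=; lra.
Qed.

Definition in_square (q : R * R) := 0 <= q.1 <= 1 /\ 0 <= q.2 <= 1.

(** On a line of slope a over the unit interval, K y - j x varies by K a - j at most,
    which is in [0, 1) for j the integer part of K a. *)
Lemma common_strip_flat (a c : R) (s : bool) : -1 <= a <= 1 ->
  exists d m, forall q, in_square q ->
    (swap_if s q).2 = a * (swap_if s q).1 + c -> Num.floor (strip_form d q) = m.
Proof.
move=> /andP[a1 a2].
have Ka : 0 <= K%:R * a + K%:R.
  have : 0 <= K%:R * (a + 1) by apply: mulr_ge0; [exact: ltW|lra].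
  lra.
have /andP[] := truncn_itv Ka; set k := Num.trunc _ => k1 k2.
have kK : (k < (2 * K).+1)%N.
  rewrite ltnS -(ler_nat R) natrM; apply: le_trans k1 _.
  have : 0 <= K%:R * (1 - a) by apply: mulr_ge0; [exact: ltW|lra].
  lra.
have [e [m hm]] := common_half_floor (K%:R * c).
exists (s, (Ordinal kK, e)), m => q [q1 q2] hq; apply: hm => /=.
have /andP[x0 x1] : 0 <= (swap_if s q).1 <= 1 by case: (s) => /=.
rewrite hq -natr1 in k2 *.
move: x0 x1; set x := (swap_if s q).1 => x0 x1.
have p1 : 0 <= (K%:R * a + K%:R - k%:R) * x by apply: mulr_ge0; lra.
have p2 : (K%:R * a + K%:R - k%:R) * x <= K%:R * a + K%:R - k%:R.
  by rewrite -[leRHS]mulr1; apply: ler_wpM2l; lra.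
apply/andP; split; lra.
Qed.

(** Stated for collinear triples because it serves twice: with v = w, every edge
    lies in a strip; with three points, general position follows from the absence
    of three points in a very thin strip. *)
Lemma common_strip (u v w : R * R) : collinear u v w ->
  in_square u -> in_square v -> in_square w ->
  exists d, Num.floor (strip_form d u) = Num.floor (strip_form d v) /\
            Num.floor (strip_form d u) = Num.floor (strip_form d w).
Proof.
move=> [a [b [c [ab h]]]] hu hv hw.
have eu : a * u.1 + b * u.2 = c by apply: h; rewrite !inE eqxx.
have ev : a * v.1 + b * v.2 = c by apply: h; rewrite !inE eqxx orbT.
have ew : a * w.1 + b * w.2 = c by apply: h; rewrite !inE eqxx !orbT.
have ratio (x y : R) : `|x| <= `|y| -> y != 0 -> -1 <= - (x / y) <= 1.
  move=> xy y0; rewrite -ler_norml normrN normrM normfV.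
  by rewrite ler_pdivrMr ?mul1r // normr_gt0.
have [le|/ltW le] := leP `|a| `|b|.
  have b0 : b != 0.
    apply: contra_neq ab => b0; move: le; rewrite b0 normr0 normr_le0 => /eqP ->.
    by [].
  have [d [m hm]] := common_strip_flat (c / b) false (ratio _ _ le b0).
  have on q : a * q.1 + b * q.2 = c -> q.2 = - (a / b) * q.1 + c / b.
    by move=> <-; field.
  by exists d; rewrite !hm //=; exact: on.
have a0 : a != 0.
  apply: contra_neq ab => a0; move: le; rewrite a0 normr0 normr_le0 => /eqP ->.
  by [].
have [d [m hm]] := common_strip_flat (c / a) true (ratio _ _ le a0).
have on q : a * q.1 + b * q.2 = c -> q.1 = - (b / a) * q.2 + c / a.
  by move=> <-; field.
by exists d; rewrite !hm //=; exact: on.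
Qed.

Lemma strip_form_range d q : in_square q ->
  exists z : 'I_(2 * K).+1, Num.floor (strip_form d q) = z%:Z - K%:Z.
Proof.
move=> [hq1 hq2]; set t := strip_form d q.
have [x [y [x0 x1 tE]]] : exists x y, [/\ 0 <= x <= 1, 0 <= y <= 1 &
    t = (K%:R * y - (d.2.1%:R - K%:R) * x + d.2.2%:R) / 2].
  by exists (swap_if d.1 q).1, (swap_if d.1 q).2; split=> //; case: (d.1).
have k1 : (d.2.1 : nat)%:R <= 2 * K%:R :> R.
  by rewrite -natrM ler_nat -ltnS.
have k0 : 0 <= (d.2.1 : nat)%:R :> R by [].
have e1 : (d.2.2 : nat)%:R <= 1 :> R by case: (d.2.2).
have e0 : 0 <= (d.2.2 : nat)%:R :> R by [].
move: k1 k0 e1 e0 tE; set k := (d.2.1 : nat)%:R; set e := (d.2.2 : nat)%:R => k1 k0 e1 e0 tE.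
have [p1 p2] : 0 <= k * x /\ k * x <= 2 * K%:R * x.
  by split; [apply: mulr_ge0; lra|apply: ler_wpM2r; lra].
have [p3 p4] : 0 <= K%:R * x /\ K%:R * x <= K%:R.
  by split; [apply: mulr_ge0; lra|rewrite -[leRHS]mulr1; apply: ler_wpM2l; lra].
have [p5 p6] : 0 <= K%:R * y /\ K%:R * y <= K%:R.
  by split; [apply: mulr_ge0; lra|rewrite -[leRHS]mulr1; apply: ler_wpM2l; lra].
have K1 : 1 <= K%:R :> R by rewrite ler1n.
have t1 : - K%:R <= t by lra.
have t2 : t < K%:R + 1 by lra.
have f1 : - K%:Z <= Num.floor t by rewrite floor_ge_int mulrNz.
have f2 : Num.floor t < K%:Z + 1 by rewrite floor_lt_int intrD.
exact: int_range.
Qed.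
End StripFamily.


(** * The area of a strip *)

Section StripMeasure.
Variables (R : realType).
Local Notation leb := (@lebesgue_measure R).
Local Open Scope ereal_scope.

Lemma area_le_xsection (A : set (R * R)) (c : R) : measurable A -> (0 <= c)%R ->
  (forall x, leb (xsection A x) <= (c%:E * (\1_(`[0%R, 1%R]%classic) x)%:E)) ->
  (leb \x leb) A <= c%:E.
Proof.
move=> mA c0 h; rewrite /product_measure1.
apply: (@le_trans _ _ (\int[leb]_x (c%:E * (\1_(`[0%R, 1%R]%classic) x)%:E))).
  apply: ge0_le_integral => //; first exact: measurable_fun_xsection.
    by apply: measurable_funeM; apply/measurable_EFinP; exact: measurable_indic.
  by move=> x _; exact: h.
rewrite ge0_integralZl //; last by apply/measurable_EFinP; exact: measurable_indic.
by rewrite integral_indic // setIT /= lebesgue_measure_itv /= lte_fin ltr01 oppr0 adde0 mule1.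
Qed.

Lemma area_le_ysection (A : set (R * R)) (c : R) : measurable A -> (0 <= c)%R ->
  (forall y, leb (ysection A y) <= (c%:E * (\1_(`[0%R, 1%R]%classic) y)%:E)) ->
  (leb \x leb) A <= c%:E.
Proof.
move=> mA c0 h.
have -> : (leb \x leb) A = (leb \x^ leb) A.
  by apply: product_measure_unique => // B C mB mC; exact: product_measure2E.
rewrite /product_measure2.
apply: (@le_trans _ _ (\int[leb]_x (c%:E * (\1_(`[0%R, 1%R]%classic) x)%:E))).
  apply: ge0_le_integral => //; first exact: measurable_fun_ysection.
    by apply: measurable_funeM; apply/measurable_EFinP; exact: measurable_indic.
  by move=> x _; exact: h.
rewrite ge0_integralZl //; last by apply/measurable_EFinP; exact: measurable_indic.
by rewrite integral_indic // setIT /= lebesgue_measure_itv /= lte_fin ltr01 oppr0 adde0 mule1.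
Qed.

Lemma affine_measurable (f : R * R -> R) : affine f -> measurable_fun setT f.
Proof.
move=> [a [b [c h]]]; rewrite (_ : f = (fun q : R * R => a * q.1 + b * q.2 + c)%R).
  by apply: measurable_funD => //; apply: measurable_funD; apply: measurable_funM.
by apply/funext.
Qed.

Lemma floor_level_measurable d (T : measurableType d) (f : T -> R) (z : int) :
  measurable_fun setT f -> measurable [set q | Num.floor (f q) = z].
Proof.
move=> mf.
have -> : [set q | Num.floor (f q) = z] =
    [set q | (z%:~R <= f q)%R] `&` ~` [set q | ((z + 1)%:~R <= f q)%R].
  apply/seteqP; split=> q /=.
    by move=> <-; have /andP[h1 h2] := floor_itv (f q); split=> //; apply/negP; rewrite -ltNge.
  by move=> [h1 /negP]; rewrite -ltNge => h2; apply: floor_def; rewrite h1.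
apply: measurableI; last apply: measurableC.
  by rewrite -[X in measurable X]setTI; apply: measurable_fun_le.
by rewrite -[X in measurable X]setTI; apply: measurable_fun_le.
Qed.

Lemma unit_squareE (q : R * R) : unit_square q = in_square q.
Proof. by rewrite /unit_square /in_square /= !in_itv. Qed.

Lemma unit_square_measurable : measurable (@unit_square R).
Proof. exact: measurableX. Qed.

Definition strip_region K (d : strip_index K) (z : int) : set (R * R) :=
  [set q | Num.floor (strip_form d q) = z].

Lemma strip_region_measurable K d z : (0 < K)%N -> measurable (@strip_region K d z).
Proof.
move=> K0; apply: floor_level_measurable; apply: affine_measurable.
exact/nonconstant_affine_affine/strip_form_affine.
Qed.

(** Every section of a strip along the axis on which it has width 2 / K is an
    interval of this length, and the sections are indexed by the unit interval. *)
Lemma strip_area K (d : strip_index K) z : (0 < K)%N ->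
  (leb \x leb) (strip_region d z `&` @unit_square R) <= (2 / K%:R)%:E.
Proof.
move=> K0; have KR : (0 < K%:R :> R)%R by rewrite ltr0n.
have mA := measurableI _ _ (strip_region_measurable d z K0) unit_square_measurable.
have c0 : (0 <= 2 / K%:R :> R)%R by rewrite divr_ge0.
have section (x : R) (B : set R) :
    (forall y, B y -> in_square (swap_if d.1 (x, y)) /\ Num.floor (strip_form d (swap_if d.1 (x, y))) = z) ->
    measurable B -> leb B <= (2 / K%:R)%:E * (\1_(`[0%R, 1%R]%classic) x)%:E.
  move=> hB mB; rewrite indicE; case: (boolP (x \in _)) => xI; last first.
    rewrite mule0 (_ : B = set0) ?measure0 //; apply/seteqP; split=> // y /hB[[h1 h2] _].
    case/negP: xI; rewrite inE /= in_itv /=.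
    by move: h1 h2; rewrite /swap_if; case: (d.1) => /=.
  rewrite mule1.
  pose a : R := ((2 * z%:~R - (d.2.2 : nat)%:R + (d.2.1%:R - K%:R) * x) / K%:R)%R.
  apply: (@le_trans _ _ (leb `[a, (a + 2 / K%:R)%R[%classic)).
    apply: le_measure; rewrite ?inE //.
    move=> y /hB[_ hz] /=; rewrite in_itv /=.
    have := floor_itv (strip_form d (swap_if d.1 (x, y))); rewrite hz intrD.
    have -> : strip_form d (swap_if d.1 (x, y)) =
        ((K%:R * y - (d.2.1%:R - K%:R) * x + (d.2.2 : nat)%:R) / 2)%R.
      by rewrite /strip_form /swap_if; case: (d.1).
    move=> /andP[h1 h2]; rewrite /a -mulrDl ler_pdivrMr // ltr_pdivlMr //; apply/andP; split; lra.
  rewrite lebesgue_measure_itv /=; case: ifP => _; last by rewrite lee_fin.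
  by rewrite -EFinB lee_fin; lra.
case E : (d.1).
- apply: area_le_ysection => // y; apply: section; last exact: measurable_ysection.
  by move=> x; rewrite /ysection /= inE E /= => -[h1]; rewrite unit_squareE.
- apply: area_le_xsection => // x; apply: section; last exact: measurable_xsection.
  by move=> y; rewrite /xsection /= inE E /= => -[h1]; rewrite unit_squareE.
Qed.
End StripMeasure.

(** * Crowded strips are unlikely *)

Section CrowdedStrips.
Local Open Scope ereal_scope.

Lemma measure_exists_le d (T : measurableType d) (R : realType)
    (mu : {measure set T -> \bar R}) (I : finType) (Q : pred I) (A : I -> set T) :
  (forall i, measurable (A i)) ->
  measurable [set w | exists2 i, Q i & A i w] /\
  mu [set w | exists2 i, Q i & A i w] <= \sum_(i | Q i) mu (A i).
Proof.
move=> mA; have -> : [set w | exists2 i, Q i & A i w] = \big[setU/set0]_(i | Q i) A i.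
  rewrite -bigcup_seq_cond; apply/seteqP; split=> w.
    by move=> [i Qi Ai]; exists i => //=; rewrite mem_index_enum.
  by move=> [i /= /andP[_ Qi] Ai]; exists i.
apply: (big_ind2 (fun (S : set T) x => measurable S /\ mu S <= x)).
- by split; rewrite ?measure0.
- move=> S x S' x' [mS hS] [mS' hS']; split; first exact: measurableU.
  by apply: le_trans (measureU2 mu mS mS') _; exact: leeD.
- by move=> i _; split.
Qed.

Variables (R : realType) (d : measure_display) (T : measurableType d) (P : probability T R).
Variables (n : nat) (X : 'I_n -> {RV P >-> (R * R)%type}).
Hypothesis indep : mutually_independent X.
Hypothesis unif : forall i, uniform_on_unit_square (X i).

Lemma X_measurable i (B : set (R * R)) : measurable B -> measurable (X i @^-1` B).
Proof. by move=> mB; rewrite -[X in measurable X]setTI; exact: measurable_funP. Qed.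

Lemma prob_uniform i (B : set (R * R)) : measurable B ->
  P (X i @^-1` B) = (lebesgue_measure \x lebesgue_measure) (B `&` @unit_square R).
Proof. by move=> mB; rewrite -(unif i mB). Qed.

Definition outside : set T := [set w | exists2 i, xpredT i & (X i @^-1` ~` @unit_square R) w].

Lemma prob_outside : measurable outside /\ P outside = 0.
Proof.
have mS := measurableC (@unit_square_measurable R).
have [m le] := @measure_exists_le _ _ _ P _ xpredT _ (fun i => X_measurable i mS).
split=> //; apply/eqP; rewrite eq_le measure_ge0 andbT; apply: (le_trans le).
rewrite big1 // => i _; apply: eq_trans (prob_uniform i mS) _.
by rewrite setICl measure0.
Qed.

Definition crowded K (m : nat) (x : strip_index K * 'I_(2 * K).+1) : set T :=
  [set w | exists2 J : {set 'I_n}, #|J| == m &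
     (\bigcap_(i in [set` J]) (X i @^-1` strip_region x.1 (x.2%:Z - K%:Z))) w].

(** Independence is used on the m points of one subset at a time, and the union
    bound over the subsets replaces a tail estimate for their number. *)
Lemma prob_crowded K (m : nat) x : (0 < K)%N -> measurable (@crowded K m x) /\
  P (@crowded K m x) <= ('C(n, m)%:R * (2 / K%:R) ^+ m)%:E.
Proof.
move=> K0; have mR := @strip_region_measurable R K x.1 (x.2%:Z - K%:Z) K0.
have mI (J : {set 'I_n}) :
    measurable (\bigcap_(i in [set` J]) (X i @^-1` strip_region x.1 (x.2%:Z - K%:Z))).
  by apply: fin_bigcap_measurable => // i _; exact: X_measurable.
have [m1 le] := @measure_exists_le _ _ _ P _ (fun J : {set 'I_n} => #|J| == m) _ mI.
split=> //; apply: (le_trans le).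
apply: (@le_trans _ _ (\sum_(J : {set 'I_n} | #|J| == m) ((2 / K%:R) ^+ m)%:E)).
  apply: lee_sum => J /eqP Jm; rewrite [leLHS](@indep J (fun=> strip_region x.1 (x.2%:Z - K%:Z)) (fun=> mR)).
  rewrite -Jm -prodr_const -prodEFin.
  suff [] : 0 <= \prod_(i in J) P (X i @^-1` strip_region x.1 (x.2%:Z - K%:Z)) /\
     \prod_(i in J) P (X i @^-1` strip_region x.1 (x.2%:Z - K%:Z)) <=
     \prod_(i in J) (2 / K%:R)%:E by [].
  apply: (big_ind2 (fun a b : \bar R => 0 <= a /\ a <= b)).
  - by rewrite lee_fin.
  - move=> a a' b b' [a0 aa] [b0 bb]; split; first exact: mule_ge0.
    exact: lee_pmul.
  - by move=> i _; split=> //; rewrite prob_uniform //; exact: strip_area.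
rewrite sumEFin lee_fin sumr_const -(mulr_natl ((2 / K%:R) ^+ m)); apply: ler_wpM2r.
  by rewrite exprn_ge0 // divr_ge0.
by have := card_draws 'I_n m; rewrite card_ord cardsE => <-.
Qed.

(** Only 2 K + 1 strips of each direction meet the unit square. *)
Definition overfull K (m : nat) : set T :=
  [set w | exists2 x : strip_index K * 'I_(2 * K).+1, xpredT x & @crowded K m x w].

Lemma prob_overfull K (m : nat) : (0 < K)%N -> measurable (overfull K m) /\
  P (overfull K m) <= ((4 * (2 * K).+1 ^ 2)%:R * ('C(n, m)%:R * (2 / K%:R) ^+ m))%:E.
Proof.
move=> K0; have hc x := @prob_crowded K m x K0.
have [m1 le] := @measure_exists_le _ _ _ P _ xpredT _ (fun x => (hc x).1).
split=> //; apply: (le_trans le).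
apply: (@le_trans _ _ (\sum_(x : strip_index K * 'I_(2 * K).+1) ('C(n, m)%:R * (2 / K%:R) ^+ m)%:E)).
  by apply: lee_sum => x _; exact: (hc x).2.
rewrite sumEFin lee_fin sumr_const -(mulr_natl ('C(n, m)%:R * (2 / K%:R) ^+ m)); apply: ler_wpM2r.
  by rewrite mulr_ge0 // exprn_ge0 // divr_ge0.
rewrite ler_nat /strip_index !card_prod card_bool !card_ord; lia.
Qed.

(** A strip with at least m points, all in the square, meets the square and so has
    one of the indices that [overfull] takes into account. *)
Lemma strip_set_small K (m : nat) w : ~ outside w -> ~ overfull K m w -> (0 < K)%N -> (0 < m)%N ->
  (forall i, in_square (X i w)) /\
  (forall (d : strip_index K) z,
     (#|strip_set (fun i => X i w) (@strip_form R K) d z| < m)%N).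
Proof.
move=> ho hf K0 m0; have sq i : in_square (X i w).
  rewrite -unit_squareE; apply: contrapT => h; apply: ho; by exists i.
split=> // c z; rewrite ltnNge; apply/negP => mz; apply: hf.
have : (0 < #|[set J : {set 'I_n} |
    J \subset strip_set (fun i => X i w) (@strip_form R K) c z & #|J| == m]%SET|)%N.
  by rewrite cards_draws bin_gt0.
move=> /card_gt0P[J]; rewrite inE => /andP[JS /eqP Jm].
have /card_gt0P[i0 i0J] : (0 < #|J|)%N by rewrite Jm.
have h i : i \in J -> Num.floor (strip_form c (X i w)) = z.
  by move=> /(fintype.subsetP JS); rewrite inE => /eqP.
have [y zy] := strip_form_range K0 c (sq i0).
exists (c, y) => //; exists J; first exact/eqP.
by move=> i /= iJ; rewrite /strip_region /= -zy !h.
Qed.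
End CrowdedStrips.

(** * Crossings in terms of orientations *)

Section CrossingSigns.
Variables (R : realType) (n : nat) (p : 'I_n -> R * R).
Implicit Types (i j k l : 'I_n) (e f : {set 'I_n}).

(** Two equal points are collinear with any third one. *)
Lemma general_position_noncollinear : (3 <= n)%N ->
  (forall i j k, i != j -> j != k -> i != k -> det (p i) (p j) (p k) != 0) ->
  general_position p.
Proof.
move=> n3 h; split=> [i j ij|i j k ij jk ik /det_collinear /eqP]; last exact/negP/h.
apply: contrapT => /eqP ne.
have : (0 < #|~: [set i; j]%SET|)%N by have := cardsC [set i; j]%SET; rewrite cards2 ne card_ord; lia.
move=> /card_gt0P[k]; rewrite !inE negb_or => /andP[ki kj].
have := h i j k ne; rewrite eq_sym kj eq_sym ki => /(_ isT isT) /eqP; apply.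
by rewrite ij /det; ring.
Qed.

Definition separates i j k l := det (p i) (p j) (p k) * det (p i) (p j) (p l) < 0.

Definition cross_signs e f : Prop := exists i j k l,
  [/\ e = [set i; j]%SET, f = [set k; l]%SET, separates i j k l & separates k l i j].

Lemma det_segment (u v a b : R * R) t :
  det u v ((1 - t) *: a + t *: b) = (1 - t) * det u v a + t * det u v b.
Proof. by rewrite /det /= /GRing.scale /=; ring. Qed.

Lemma det_on_segment (u v : R * R) s : det u v ((1 - s) *: u + s *: v) = 0.
Proof. by rewrite /det /= /GRing.scale /=; ring. Qed.

Hypothesis gp : general_position p.

Lemma endpoint_not_inside i j s : i != j -> 0 < s -> s < 1 ->
  (1 - s) *: p i + s *: p j <> p i /\ (1 - s) *: p i + s *: p j <> p j.
Proof.
move=> ij s0 s1; have ne : p i <> p j by move=> /(gp.1) E; rewrite E eqxx in ij.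
have key (u v : R * R) t : 0 < t -> (1 - t) *: u + t *: v = u -> u = v.
  move=> t0; rewrite [u]surjective_pairing [v]surjective_pairing => -[] /=.
  rewrite /GRing.scale /= => h1 h2.
  have e1 : t * (u.1 - v.1) = 0 by lra.
  have e2 : t * (u.2 - v.2) = 0 by lra.
  move/eqP: e1; move/eqP: e2; rewrite !mulf_eq0 !(gt_eqF t0) /= !subr_eq0.
  by move=> /eqP -> /eqP ->.
split; first by move/(key _ _ _ s0).
move=> h; apply: ne; apply/esym; apply: (key _ _ (1 - s)); first by lra.
by rewrite addrC -[RHS]h; congr (_ + _ *: _); ring.
Qed.

(** If k were on the line of the first edge, then l would be too, and in general
    position both would be among i and j; the edges would then be equal, or one
    of them degenerate and at an end of the other. *)
Lemma crossing_det_neq0 i j k l s t : [set i; j]%SET != [set k; l]%SET ->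
  0 < s -> s < 1 -> 0 < t -> t < 1 ->
  (1 - s) *: p i + s *: p j = (1 - t) *: p k + t *: p l ->
  det (p i) (p j) (p k) != 0.
Proof.
move=> ne s0 s1 t0 t1 E; apply/eqP => h.
have h' : det (p i) (p j) (p l) = 0.
  have := det_on_segment (p i) (p j) s; rewrite E det_segment h mulr0 add0r => /eqP.
  by rewrite mulf_eq0 gt_eqF //= => /eqP.
have [ij|ij] := eqVneq i j.
  subst j; have Ei : (1 - t) *: p k + t *: p l = p i.
    by rewrite -E -scalerDl subrK scale1r.
  have [kl|kl] := eqVneq k l.
    subst l; move: Ei; rewrite -scalerDl subrK scale1r => /(gp.1) ki.
    by rewrite ki eqxx in ne.
  have [n1 n2] := endpoint_not_inside kl t0 t1.
  have : det (p k) (p l) (p i) = 0 by rewrite -Ei det_on_segment.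
  case/(general_position_det gp) => [kl'|li|ki]; first by rewrite kl' eqxx in kl.
    by apply: n2; rewrite Ei li.
  by apply: n1; rewrite Ei ki.
have [n1 n2] := endpoint_not_inside ij s0 s1.
have kij : k = i \/ k = j.
  by case/(general_position_det gp): h => [ij'|jk|ik]; [rewrite ij' eqxx in ij|right|left].
have lij : l = i \/ l = j.
  by case/(general_position_det gp): h' => [ij'|jk|ik]; [rewrite ij' eqxx in ij|right|left].
have deg m : k = m -> l = m -> (1 - s) *: p i + s *: p j = p m.
  by move=> km lm; rewrite E km lm -scalerDl subrK scale1r.
case: kij lij => [ki|kj] [li|lj].
- exact: n1 (deg _ ki li).
- by rewrite ki lj eqxx in ne.
- by rewrite kj li finset.setUC eqxx in ne.
- exact: n2 (deg _ kj lj).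
Qed.

Lemma separates_crossing i j k l s t : [set i; j]%SET != [set k; l]%SET ->
  0 < s -> s < 1 -> 0 < t -> t < 1 ->
  (1 - s) *: p i + s *: p j = (1 - t) *: p k + t *: p l -> separates i j k l.
Proof.
move=> ne s0 s1 t0 t1 E; have := crossing_det_neq0 ne s0 s1 t0 t1 E.
have := det_on_segment (p i) (p j) s; rewrite E det_segment /separates.
set a := det _ _ (p k); set b := det _ _ (p l) => h a0.
have -> : a * b = - ((1 - t) / t * a ^+ 2).
  have -> : b = - ((1 - t) * a) / t by apply: (mulIf (lt0r_neq0 t0)); rewrite mulfVK ?lt0r_neq0 //; lra.
  by field; exact: lt0r_neq0.
rewrite oppr_lt0; apply: mulr_gt0; first by apply: divr_gt0; lra.
by rewrite exprn_even_gt0.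
Qed.

Lemma segments_meet i j k l : separates i j k l -> separates k l i j ->
  (open_segment (p i) (p j) `&` open_segment (p k) (p l) !=set0)%classic.
Proof.
rewrite /separates.
have ratio (a b : R) : a * b < 0 -> [/\ a - b != 0, 0 < a / (a - b) & a / (a - b) < 1].
  move=> ab; have [a0|a0|a0] := ltgtP a 0; last by rewrite a0 mul0r ltxx in ab.
    have b0 : 0 < b by rewrite nmulr_rlt0 in ab.
    split; [lra| |].
      by rewrite -mulrNN -invrN; apply: divr_gt0; lra.
    by rewrite ltr_ndivrMr; lra.
  have b0 : b < 0 by rewrite pmulr_rlt0 in ab.
  split; [lra| |]; first by apply: divr_gt0; lra.
  by rewrite ltr_pdivrMr; lra.
move=> /ratio[n1 t0 t1] /ratio[n2 s0 s1].
set t := _ / _ in t0 t1; set s := _ / _ in s0 s1.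
exists ((1 - s) *: p i + s *: p j); split; apply/open_segmentP; first by exists s.
exists t; split=> //; move: n1 n2; rewrite /s /t /det.
case: (p i) => x1 y1; case: (p j) => x2 y2; case: (p k) => x3 y3; case: (p l) => x4 y4 /= n1 n2.
rewrite /GRing.scale /=; congr pair; rewrite /= /GRing.scale /=; field; by rewrite n1 n2.
Qed.

(** The right-hand side is a finite Boolean combination of polynomial inequalities
    in the coordinates. *)
Lemma edges_crossE e f : edges_cross p e f <-> cross_signs e f.
Proof.
split=> [[i [j [k [l [eE fE ne [q [/open_segmentP[s [s0 s1 ->]] /open_segmentP[t [t0 t1 E]]]]]]]]]|].
  exists i, j, k, l; split=> //; first by apply: separates_crossing E; rewrite -?eE -?fE.
  by apply: separates_crossing (esym E); rewrite -?eE -?fE // eq_sym.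
move=> [i [j [k [l [eE fE h1 h2]]]]]; exists i, j, k, l; split=> //; last exact: segments_meet.
apply/eqP; rewrite eE fE => /set2_inj[[ik jl]|[il jk]]; move: h1; rewrite /separates.
  by subst k; rewrite (_ : det _ _ (p i) = 0) ?mul0r ?ltxx // /det; ring.
by subst l; rewrite (_ : det _ _ (p i) = 0) ?mulr0 ?ltxx // /det; ring.
Qed.
End CrossingSigns.

(** * Measurability of the covering event *)

Section EventMeasurable.
Variables (R : realType) (n : nat) (d : measure_display) (T : measurableType d).
Implicit Types (I : finType).

Definition event (A : T -> Prop) := measurable [set w | A w].

Lemma event_exists I (A : I -> T -> Prop) :
  (forall i, event (A i)) -> event (fun w => exists i, A i w).
Proof.
move=> h; rewrite /event (_ : [set w | _] = \bigcup_(i in [set: I]) [set w | A i w]).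
  by apply: fin_bigcup_measurable => [|i _]; [exact: finite_finset|exact: h].
by apply/seteqP; split=> w [i]; [exists i|move=> _ Ai; exists i].
Qed.

Lemma event_forall I (A : I -> T -> Prop) :
  (forall i, event (A i)) -> event (fun w => forall i, A i w).
Proof.
move=> h; rewrite /event (_ : [set w | _] = \bigcap_(i in [set: I]) [set w | A i w]).
  by apply: fin_bigcap_measurable => [|i _]; [exact: finite_finset|exact: h].
by apply/seteqP; split=> w H i; [move=> _|]; exact: H.
Qed.

Lemma event_and (A B : T -> Prop) : event A -> event B -> event (fun w => A w /\ B w).
Proof. exact: measurableI. Qed.

Lemma event_cst (Q : Prop) : event (fun=> Q).
Proof.
rewrite /event; have [q|q] := pselect Q.
  by rewrite (_ : [set w | Q] = setT) //; apply/seteqP; split.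
by rewrite (_ : [set w | Q] = set0) //; apply/seteqP; split.
Qed.

Lemma event_not (A : T -> Prop) : event A -> event (fun w => ~ A w).
Proof. exact: measurableC. Qed.

Lemma event_implies (Q : Prop) (A : T -> Prop) : event A -> event (fun w => Q -> A w).
Proof.
move=> mA; have [q|q] := pselect Q.
  by rewrite (_ : (fun w => Q -> A w) = A) //; apply/funext => w; apply/propext; split; auto.
rewrite (_ : (fun w => Q -> A w) = (fun=> True)); first exact: event_cst.
by apply/funext => w; apply/propext; split.
Qed.

(** The covering event with an arbitrary crossing relation, so that the geometric
    one can be replaced by the one given by orientation signs. *)
Definition covering_with (C : R) (cr : {set 'I_n} -> {set 'I_n} -> Prop) :=
  covered_by_at_most (C * (n%:R * log2 n%:R))
    (fun E => is_path E /\ (forall e f, e \in E -> f \in E -> ~ cr e f)) /\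
  covered_by_at_most (C * (n%:R * Num.sqrt (log2 n%:R)))
    (fun E => is_matching E /\ (forall e f, e \in E -> f \in E -> ~ cr e f)).

(** Families, subgraphs and edges range over finite types, so all quantifiers are
    finite unions and intersections. *)
Lemma covering_with_event C (cr : T -> {set 'I_n} -> {set 'I_n} -> Prop) :
  (forall e f, event (fun w => cr w e f)) -> event (fun w => covering_with C (cr w)).
Proof.
move=> h.
have cov (c : R) (Q : {set {set 'I_n}} -> Prop) : event (fun w =>
    covered_by_at_most c (fun E => Q E /\ (forall e f, e \in E -> f \in E -> ~ cr w e f))).
  apply: event_exists => F.
  rewrite (_ : (fun w => _) = fun w => #|F|%:R <= c /\
     (complete_edges n \subset finset.cover F /\ (forall E, E \in F -> Q E /\
       (forall e f, e \in E -> f \in E -> ~ cr w e f)))); last first.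
    by apply/funext => w; apply/propext; split=> [[]|[? []]].
  apply: event_and; first exact: event_cst.
  apply: event_and; first exact: event_cst.
  apply: event_forall => E; apply: event_implies.
  apply: event_and; first exact: event_cst.
  apply: event_forall => e; apply: event_forall => f.
  by do 2 apply: event_implies; apply: event_not.
exact: event_and.
Qed.

Variable X : 'I_n -> T -> R * R.
Hypothesis mX : forall i, measurable_fun setT (X i).
Hypothesis n3 : (3 <= n)%N.

Let det_X i j k w := det (X i w) (X j w) (X k w).

Lemma det_X_measurable i j k : measurable_fun setT (det_X i j k).
Proof.
have m1 i1 : measurable_fun setT (fun w => (X i1 w).1) by exact: measurableT_comp.
have m2 i1 : measurable_fun setT (fun w => (X i1 w).2) by exact: measurableT_comp.
by rewrite /det_X /det; apply: measurable_funB; apply: measurable_funM; apply: measurable_funB.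
Qed.

Lemma event_lt (g h : T -> R) : measurable_fun setT g -> measurable_fun setT h ->
  event (fun w => g w < h w).
Proof.
move=> mg mh; rewrite /event (_ : [set w | _] = ~` [set w | h w <= g w]).
  by apply: measurableC; rewrite -[X in measurable X]setTI; apply: measurable_fun_le.
by apply/seteqP; split=> w /=; [rewrite ltNge => /negP|rewrite ltNge => /negP].
Qed.

Lemma covering_event_measurable (C : R) :
  measurable [set w | general_position (X^~ w) /\ covering_event C (X^~ w)].
Proof.
have -> : [set w | general_position (X^~ w) /\ covering_event C (X^~ w)] =
    [set w | (forall i j k, i != j -> j != k -> i != k -> det_X i j k w != 0) /\
             covering_with C (cross_signs (X^~ w))].
  have cE w : general_position (X^~ w) ->
      covering_event C (X^~ w) = covering_with C (cross_signs (X^~ w)).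
    move=> gp; have -> : cross_signs (X^~ w) = edges_cross (X^~ w) by
      apply/funext => e; apply/funext => f; apply/propext; split; move/(edges_crossE gp).
    by [].
  apply/seteqP; split=> w /= [gp].
    rewrite cE // => h; split=> // i j k ij jk ik; apply/eqP => /collinear_det.
    exact: gp.2.
  have gp' := general_position_noncollinear n3 gp.
  by rewrite cE.
apply: event_and.
  apply: event_forall => i; apply: event_forall => j; apply: event_forall => k.
  do 3 apply: event_implies.
  rewrite /event (_ : [set w | _] = [set w | det_X i j k w < 0] `|` [set w | 0 < det_X i j k w]).
    by apply: measurableU; apply: event_lt => //; exact: det_X_measurable.
  by apply/seteqP; split=> w /=; rewrite neq_lt => /orP.
apply: covering_with_event => e f.
apply: event_exists => i; apply: event_exists => j.
apply: event_exists => k; apply: event_exists => l.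
have sep i1 j1 k1 l1 : event (fun w => separates (X^~ w) i1 j1 k1 l1).
  apply: event_lt => //; apply: measurable_funM; exact: det_X_measurable.
rewrite (_ : (fun w => _) = fun w => (e = [set i; j]%SET /\ f = [set k; l]%SET) /\
    (separates (X^~ w) i j k l /\ separates (X^~ w) k l i j)).
  by apply: event_and; [exact: event_cst|exact: event_and].
by apply/funext => w; apply/propext; split=> [[? ? ? ?]|[[? ?] [? ?]]].
Qed.
End EventMeasurable.

(** * Numerical estimates *)

Section Counting.
Local Open Scope nat_scope.

(** The quotient of m^m by m! is at most the central binomial coefficient, a product of
    m factors (m + i) / i. *)
Lemma exp_self_le_fact m : m ^ m <= 4 ^ m * m`!.
Proof.
have h : 'C(2 * m, m) <= 4 ^ m.
  rewrite (_ : 4 ^ m = 2 ^ (2 * m)); last by rewrite expnM.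
  have := Pascal 1 1 (2 * m); rewrite /= => ->.
  rewrite (bigD1 (inord m : 'I_(2 * m).+1)) //= inordK; last by lia.
  by rewrite !exp1n !muln1 leq_addr.
apply: leq_trans (leq_mul h (leqnn _)); rewrite bin_ffact.
have ff : forall k, k <= m -> m ^ k <= (2 * m) ^_ k.
  elim=> [|k IH] km; first by rewrite expn0 ffactn0.
  by rewrite expnSr ffactnSr; apply: leq_mul; [apply: IH; lia|lia].
exact: ff.
Qed.

Lemma ffact_le_exp n m : n ^_ m <= n ^ m.
Proof.
elim: m => [|m IH]; first by rewrite ffactn0 expn0.
by rewrite ffactnSr expnSr; apply: leq_mul => //; apply: leq_subr.
Qed.

Lemma bin_exp_le n m : 'C(n, m) * m ^ m <= (4 * n) ^ m.
Proof.
apply: leq_trans (leq_mul (leqnn _) (exp_self_le_fact m)) _.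
by rewrite mulnCA bin_ffact expnMn leq_mul // ffact_le_exp.
Qed.

(** For strips of area at most 2 / K <= 4 a / n and m = 64 a, the expected number of
    m-subsets in a strip is at most 4^-m. *)
Lemma bin_strip_le n K a : 0 < a -> n <= 2 * K * a ->
  'C(n, 64 * a) * 8 ^ (64 * a) <= K ^ (64 * a).
Proof.
move=> a0 h; set m := 64 * a; have m0 : 0 < m ^ m by rewrite expn_gt0 muln_gt0 a0.
rewrite -(leq_pmul2r m0) mulnAC; apply: leq_trans (leq_mul (bin_exp_le n m) (leqnn _)) _.
rewrite -!expnMn leq_exp2r /m; nia.
Qed.

(** The order of magnitude of log n is taken to be a power of 4, so that its square
    root is the integer 2^s. The last bound makes 4^-m beat the number of strips. *)
Lemma log_scale n : 1 < n -> exists s,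
  [/\ 4 ^ s <= trunc_log 2 n, 0 < n %/ 4 ^ s, n %/ 4 ^ s * 4 ^ s <= n,
      n <= 2 * (n %/ 4 ^ s) * 4 ^ s & n ^ 4 <= 4 ^ (64 * 4 ^ s)].
Proof.
move=> n1; set l := trunc_log 2 n; exists (trunc_log 4 l); set a := 4 ^ _.
have n0 : 0 < n by lia.
have /andP[l1 l2] := trunc_log_bounds (isT : 1 < 2) n0.
have l0 : 0 < l by rewrite /l trunc_log_gt0.
have /andP[a1 a2] := trunc_log_bounds (isT : 1 < 4) l0.
have a0 : 0 < a by rewrite expn_gt0.
have ln : l < n by apply: leq_trans (ltn_expl _ _) l1.
have an : a <= n by apply: leq_trans a1 (ltnW ln).
have K0 : 0 < n %/ a by rewrite divn_gt0.
split=> //; first exact: leq_trunc_div.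
  by have := ltn_ceil n a0; nia.
have -> : 4 ^ (64 * a) = (2 ^ (32 * a)) ^ 4.
  by rewrite -expnM (_ : 4 = 2 ^ 2) // -expnM; congr (_ ^ _); lia.
rewrite leq_exp2r //; apply: leq_trans (ltnW l2) _; rewrite leq_exp2l //.
by move: a2; rewrite expnS -/a; lia.
Qed.
End Counting.

(** * The probability of the covering event *)

Section GoodEvent.
Variables (R : realType) (d : measure_display) (T : measurableType d) (P : probability T R).
Variables (n : nat) (X : 'I_n -> {RV P >-> (R * R)%type}).
Hypothesis indep : mutually_independent X.
Hypothesis unif : forall i, uniform_on_unit_square (X i).
Hypothesis n3 : (3 <= n)%N.

Let n0 : (0 < n ^ 4)%N. Proof. by rewrite expn_gt0; lia. Qed.

Lemma general_position_not_overfull w : ~ outside X w -> ~ overfull X (n ^ 4)%N 3 w ->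
  general_position (fun i => X i w).
Proof.
move=> ho hf; have [sq small] := strip_set_small ho hf n0 isT.
apply: general_position_noncollinear => // i j k ij jk ik.
apply/eqP => /collinear_det h.
have [c [cj ck]] := common_strip n0 h (sq i) (sq j) (sq k).
have := small c (Num.floor (strip_form c (X i w))); rewrite ltnNge => /negP; apply.
apply: (@leq_trans #|i |: [set j; k]%SET|).
  by rewrite cardsU1 cards2 !inE negb_or ij ik jk.
apply: subset_leq_card; apply/fintype.subsetP => v; rewrite !inE.
by move=> /or3P[] /eqP ->; rewrite /strip; [|rewrite cj|rewrite ck]; exact: eqxx.
Qed.

Lemma log2_trunc_log : (trunc_log 2 n)%:R <= log2 n%:R :> R.
Proof.
have l2 : 0 < ln 2 :> R by apply: ln_gt0; lra.
have n0R : 0 < n%:R :> R by rewrite ltr0n; lia.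
rewrite /log2 ler_pdivlMr // mulr_natl -lnXn // ler_ln ?posrE ?exprn_gt0 //.
by rewrite -natrX ler_nat trunc_logP //; lia.
Qed.

(** There are at most 12 K directions, and m = 4^(s + 3) points in a strip: this gives
    12 K m^2 = 12 * 2^12 * K 4^s 4^s paths and 12 K * 21 m^(3/2) = 252 * 2^9 * K 4^s 2^s
    matchings, where K 4^s <= n and 4^s is at most the logarithm of n. *)
Lemma covering_not_overfull s w : let K := (n %/ 4 ^ s)%N in
  (4 ^ s <= trunc_log 2 n)%N -> (0 < K)%N -> (K * 4 ^ s <= n)%N ->
  general_position (fun i => X i w) ->
  ~ outside X w -> ~ overfull X K (4 ^ (s + 3))%N w ->
  covering_event (2 ^+ 17) (fun i => X i w).
Proof.
move=> K sl K0 Kn gp ho hf.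
have m0 : (0 < 4 ^ (s + 3))%N by rewrite expn_gt0.
have [sq small] := strip_set_small ho hf K0 m0.
have nf (c : strip_index K) : nonconstant_affine (@strip_form R K c) by exact: strip_form_affine.
have thin (c : strip_index K) z :
  (#|strip_set (fun i => X i w) (@strip_form R K) c z| <= 4 ^ (s + 3))%N by exact/ltnW/small.
have pairs i j : exists c : strip_index K,
    strip (fun i => X i w) (@strip_form R K) c i = strip (fun i => X i w) (@strip_form R K) c j.
  have h : collinear (X i w) (X j w) (X j w) by apply: collinear_det; rewrite /det; ring.
  by have [c [cj _]] := common_strip K0 h (sq i) (sq j) (sq j); exists c.
have cD : (#|{: strip_index K}| <= 12 * K)%N.
  by rewrite /strip_index !card_prod card_bool card_ord; lia.
have l0 := log2_trunc_log.
have sl' : (4 ^ s)%:R <= log2 n%:R :> R by apply: le_trans l0; rewrite ler_nat.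
split.
  apply: (strips_path_cover gp nf thin pairs).
  apply: (@le_trans _ _ (2 ^ 17 * (K * 4 ^ s * 4 ^ s))%N%:R).
    rewrite ler_nat; apply: leq_trans (leq_mul cD (leqnn _)) _.
    rewrite expnD (_ : (4 ^ 3 = 2 ^ 6)%N) // -[17%N]/(5 + (6 + 6))%N !(expnD 2).
    move: (2 ^ 6)%N (4 ^ s)%N => q u.
    have -> : (12 * K * (u * q * (u * q)) = 12 * (q * q * (K * u * u)))%N by ring.
    by rewrite -(mulnA (2 ^ 5)%N) leq_mul.
  rewrite natrM natrX; apply: ler_wpM2l; first by rewrite exprn_ge0.
  rewrite natrM; apply: ler_pM => //; by rewrite ler_nat.
apply: (strips_matching_cover gp nf thin pairs).
apply: (@le_trans _ _ (2 ^ 17 * (K * 4 ^ s * 2 ^ s))%N%:R).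
  rewrite ler_nat; apply: leq_trans (leq_mul cD (leqnn _)) _.
  have -> : (8 ^ (s + 3) = 2 ^ 9 * (4 ^ s * 2 ^ s))%N by rewrite expnD -expnMn mulnC.
  rewrite -[17%N]/(8 + 9)%N !(expnD 2).
  move: (2 ^ 9)%N (4 ^ s * 2 ^ s)%N (mulnA K (4 ^ s)%N (2 ^ s)%N) => q u <-.
  have -> : (12 * K * (21 * (q * u)) = 12 * 21 * (q * (K * u)))%N by ring.
  by rewrite -(mulnA (2 ^ 8)%N) leq_mul.
rewrite natrM natrX; apply: ler_wpM2l; first by rewrite exprn_ge0.
rewrite natrM; apply: ler_pM => //; first by rewrite ler_nat.
have -> : (2 ^ s)%:R = Num.sqrt (4 ^ s)%:R :> R.
  by rewrite (_ : (4 ^ s = (2 ^ s) ^ 2)%N) ?natrX ?sqrtr_sqr ?ger0_norm // -?natrX // -expnM mulnC expnM.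
exact: ler_wsqrtr.
Qed.

(** The term 36 / n bounds the probability that a strip of width 2 / K is crowded, and
    288 / n that a strip of width 2 / n^4 contains three points. *)
Lemma prob_covering_event :
  ((1 - 324 / n%:R)%:E <= P [set w | general_position (fun i => X i w) /\
        covering_event (2 ^+ 17) (fun i => X i w)])%E.
Proof.
have n1 : (1 < n)%N by lia.
have [s [s1 s2 s3 s4 s5]] := log_scale n1; set K := (n %/ 4 ^ s)%N in s2 s3 s4.
have [mo po] := prob_outside unif.
have [m1 p1] := prob_overfull indep unif (4 ^ (s + 3))%N s2.
have [m2 p2] := prob_overfull indep unif 3 n0.
set bad := outside X `|` (overfull X K (4 ^ (s + 3))%N `|` overfull X (n ^ 4)%N 3).
have mb : measurable bad by do 2 apply: measurableU => //.
have nR : 0 < n%:R :> R by rewrite ltr0n; lia.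
have KR : 0 < K%:R :> R by rewrite ltr0n.
have quad k : (0 < k)%N -> (4 * (2 * k).+1 ^ 2)%:R <= 36 * k%:R ^+ 2 :> R.
  by move=> k0; rewrite -natrX -natrM ler_nat; nia.
have b1 : (4 * (2 * K).+1 ^ 2)%:R * ('C(n, 4 ^ (s + 3))%:R * (2 / K%:R) ^+ (4 ^ (s + 3))%N) <= 36 / n%:R :> R.
  have Kn : K%:R ^+ 2 <= n%:R ^+ 2 :> R.
    by rewrite lerXn2r ?nnegrE // ler_nat leq_div.
  have -> : (4 ^ (s + 3) = 64 * 4 ^ s)%N by rewrite expnD mulnC.
  have a0 : (0 < 4 ^ s)%N by rewrite expn_gt0.
  have hb := bin_strip_le a0 s4.
  set m := (64 * 4 ^ s)%N in hb s5 *.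
  have h2 : 'C(n, m)%:R * (2 / K%:R) ^+ m <= (n%:R ^+ 4)^-1 :> R.
    rewrite expr_div_n mulrA ler_pdivrMr ?exprn_gt0 // ler_pdivlMl ?exprn_gt0 //.
    rewrite -!natrX -!natrM ler_nat; apply: leq_trans hb.
    have -> : (8 ^ m = 4 ^ m * 2 ^ m)%N by rewrite -expnMn.
    by rewrite mulnCA; apply: leq_mul => //; apply: leq_mul.
  apply: (@le_trans _ _ (36 * n%:R ^+ 2 * (n%:R ^+ 4)^-1)).
    apply: ler_pM => //.
    by apply: le_trans (quad K s2) _; apply: ler_wpM2l.
  have -> : 36 * n%:R ^+ 2 * (n%:R ^+ 4)^-1 = 36 / n%:R * (n%:R)^-1 :> R.
    by field; exact: lt0r_neq0.
  rewrite -[leRHS]mulr1; apply: ler_wpM2l; first by rewrite divr_ge0.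
  by rewrite invf_le1 // ler1n; lia.
have b2 : (4 * (2 * n ^ 4).+1 ^ 2)%:R * ('C(n, 3)%:R * (2 / (n ^ 4)%:R) ^+ 3) <= 288 / n%:R :> R.
  have hC : 'C(n, 3)%:R <= n%:R ^+ 3 :> R.
    rewrite -natrX ler_nat; apply: leq_trans (ffact_le_exp n 3).
    by rewrite -bin_ffact leq_pmulr.
  apply: (@le_trans _ _ (36 * (n ^ 4)%:R ^+ 2 * (n%:R ^+ 3 * (2 / (n ^ 4)%:R) ^+ 3))).
    apply: ler_pM => //.
      exact: quad.
    by apply: ler_wpM2r => //; rewrite exprn_ge0 // divr_ge0.
  by rewrite natrX le_eqVlt; apply/orP; left; apply/eqP; field; exact: lt0r_neq0.
have pb : (P bad <= (324 / n%:R)%:E)%E.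
  apply: (le_trans (measureU2 P mo (measurableU _ _ m1 m2))).
  rewrite [X in (X + _)%E]po add0e.
  apply: (le_trans (measureU2 P m1 m2)).
  apply: (le_trans (leeD p1 p2)); rewrite -EFinD lee_fin.
  by have -> : 324 / n%:R = 36 / n%:R + 288 / n%:R :> R; [field; exact: lt0r_neq0|exact: lerD].
have mX i : measurable_fun setT (X i) by exact: measurable_funP.
have me := @covering_event_measurable R n d T (fun i w => X i w) mX n3 (2 ^+ 17).
apply: (@le_trans _ _ (P (~` bad))).
  rewrite probability_setC // EFinB; apply: leeB => //.
apply: le_measure; rewrite ?inE //; first exact: measurableC.
move=> w hw; have ho : ~ outside X w by move=> h; apply: hw; left.
have h1 : ~ overfull X K (4 ^ (s + 3))%N w by move=> h; apply: hw; right; left.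
have h2 : ~ overfull X (n ^ 4)%N 3 w by move=> h; apply: hw; right; right.
have gp := general_position_not_overfull ho h2.
by split => //=; exact: covering_not_overfull gp ho h1.
Qed.
End GoodEvent.

Theorem theorem2 (R : realType) :
  exists C : R, 0 < C /\
  forall (d : nat -> measure_display) (T : forall n : nat, measurableType (d n))
    (P : forall n : nat, probability (T n) R)
    (X : forall n : nat, 'I_n -> {RV (P n) >-> (R * R)%type}),
    (forall n : nat, mutually_independent (X n)) ->
    (forall (n : nat) (i : 'I_n), uniform_on_unit_square (X n i)) ->
    (fun n : nat => P n [set w : T n |
        general_position (fun i : 'I_n => X n i w) /\
        covering_event C (fun i : 'I_n => X n i w)]) @ \oo --> 1%E.
Proof.
exists (2 ^+ 17); split; first by rewrite exprn_gt0.
move=> d T P X indep unif.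
(* harmonic n is 1 / (n + 1), and 324 / n <= 648 / (n + 1) *)
apply: (@squeeze_cvge _ _ _ _ (fun n => (1 - 648 * harmonic n)%:E) _ (cst 1%E)).
- near=> n; have n3 : (3 <= n)%N by near: n; exists 3%N.
  apply/andP; split.
    apply: le_trans (prob_covering_event (indep n) (unif n) n3).
    have nR : 0 < n%:R :> R by rewrite ltr0n; lia.
    rewrite lee_fin lerD2l lerN2 /harmonic /=.
    rewrite ler_pdivrMr // mulrAC ler_pdivlMr ?ltr0n // -natrM.
    by rewrite -!natrM ler_nat; lia.
  apply: probability_le1.
  have mX i : measurable_fun setT (X n i) by exact: measurable_funP.
  exact: (@covering_event_measurable R n (d n) (T n) (fun i w => X n i w) mX n3).
- apply: cvg_EFin; first exact: nearW.
  rewrite [X in _ --> X](_ : 1 = 1 - 648 * 0 :> R); last by rewrite mulr0 subr0.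
  by apply: cvgB; [exact: cvg_cst|apply: cvgM; [exact: cvg_cst|exact: cvg_harmonic]].
- exact: cvg_cst.
Unshelve. all: by end_near.
Qed.
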